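(* Let $\mathcal{F}$ be a saturated fusion system on a finite $p$-group $S$, $\mathcal{T}$ a transporter system associated to $\mathcal{F}$, $X$ a finite set, and $\theta:\pi_1(|\mathcal{T}|)\to\Sigma_X$ a homomorphism, equivalently a map $\theta:\mathrm{Mor}(\mathcal{T})\to\Sigma_X$ sending composition to multiplication and inclusions to the identity. Let $\mathfrak{X}^\theta$ be the resulting fusion action system, and suppose that $\mathrm{Ob}(\mathcal{T})$ contains all $X$-centric subgroups of $S$. For $P\in\mathrm{Ob}(\mathcal{T})$ put $E(P)=\ker[\mathcal{T}(P)\to\mathcal{F}^\theta(P)]$ and $K(P)=\ker[\theta:\mathcal{T}(P)\to\Sigma_X]$. Then for any $X$-centric $P\le S$ there is a unique $p'$-group $EK'(P)$ such that $$E(P)\cap K(P)=\widehat{Z(P;X)}\times EK'(P),$$ and $EK'(P)$ is the subgroup of all $p'$-elements of $E(P)\cap K(P)$. Consequently, if $\mathcal{L}^\theta$ is the category whose objects are the $X$-centric subgroups of $S$ and whose morphisms are $\mathcal{L}^\theta(P,Q)=\mathcal{T}(P,Q)/EK'(P)$, then $\mathcal{L}^\theta$ (with the functors induced by the structure functors of $\mathcal{T}$ and by $\theta$) is an $X$-centric linking action system associated to $\mathfrak{X}^\theta$.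
   Context: $p$ is a prime; $\Sigma_X$ is the symmetric group on $X$; $c_s$ is conjugation $h\mapsto shs^{-1}$; $\mathrm{Inj}(P,Q)$ is the set of injective homomorphisms. A fusion system $\mathcal{F}$ on $S$ is a category whose objects are all subgroups of $S$, with $\mathcal{F}(P,Q)\subseteq\mathrm{Inj}(P,Q)$ containing all $c_s|_P$ for $s\in S$, $sPs^{-1}\le Q$, such that every morphism factors as an isomorphism of $\mathcal{F}$ followed by an inclusion. Subgroups isomorphic in $\mathcal{F}$ are $\mathcal{F}$-conjugate. $P$ is fully normalized (centralized) if $|N_S(P)|\ge|N_S(Q)|$ (resp. $|Z_S(P)|\ge|Z_S(Q)|$) for all $Q$ conjugate to $P$. $\mathrm{Aut}_S(P)=\{c_s|_P:s\in N_S(P)\}$. $\mathcal{F}$ is saturated if every fully normalized $P$ is fully centralized with $\mathrm{Aut}_S(P)\in\mathrm{Syl}_p(\mathcal{F}(P))$, and for every fully centralized $Q$ and isomorphism $\varphi\in\mathcal{F}(P,Q)$ there is $\widetilde\varphi\in\mathcal{F}(N_\varphi,S)$ extending $\varphi$, where $N_\varphi=\{n\in N_S(P):\varphi c_n\varphi^{-1}\in\mathrm{Aut}_S(Q)\}$. For a set $\mathcal{H}$ of subgroups of $S$, $\mathcal{T}_S^{\mathcal{H}}(S)$ is the category with object set $\mathcal{H}$ and morphisms $N_S(P,Q)=\{s\in S:sPs^{-1}\le Q\}$. An (abstract) transporter system associated to $\mathcal{F}$ is a category $\mathcal{T}$ whose objects are a set of subgroups of $S$ closed under $\mathcal{F}$-conjugacy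 and overgroups, with functors $\mathcal{T}_S^{\mathrm{Ob}(\mathcal{T})}(S)\xrightarrow{\delta}\mathcal{T}\xrightarrow{\pi}\mathcal{F}$ (write $\widehat s=\delta_{P,Q}(s)$, $c_{\mathfrak{g}}=\pi_{P,Q}(\mathfrak{g})$, and $\widehat R=\delta_{P,P}(R)$ for $R\le N_S(P)$) such that: (A1) on objects $\delta$ is the identity and $\pi$ the inclusion; (A2) with $E(P)=\ker[\mathcal{T}(P)\to\mathcal{F}(P)]$, $E(P)$ acts right-freely and $E(Q)$ left-freely on $\mathcal{T}(P,Q)$, and $\pi_{P,Q}$ is the orbit map of the $E(P)$-action; (B) $\delta$ is injective on morphisms and $c_{\widehat s}=c_s$; (C) $\widehat{c_{\mathfrak{g}}(p)}\circ\mathfrak{g}=\mathfrak{g}\circ\widehat p$ for $\mathfrak{g}\in\mathcal{T}(P,Q)$, $p\in P$; (I) $\delta_{S,S}(S)\in\mathrm{Syl}_p(\mathcal{T}(S))$; (II) for every isomorphism $\mathfrak{g}\in\mathcal{T}(P,Q)$ and $P\trianglelefteq\widetilde P\le S$, $Q\trianglelefteq\widetilde Q\le S$ with $\mathfrak{g}\,\delta_{P,P}(\widetilde P)\,\mathfrak{g}^{-1}\le\delta_{Q,Q}(\widetilde Q)$, there is $\widetilde{\mathfrak{g}}\in\mathcal{T}(\widetilde P,\widetilde Q)$ with $\widetilde{\mathfrak{g}}\circ\delta_{P,\widetilde P}(1)=\delta_{Q,\widetilde Q}(1)\circ\mathfrak{g}$. The inclusions of $\mathcal{T}$ are the morphisms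 $\delta_{P,Q}(1)$, $P\le Q$. $S$ acts on $X$ by $\ell_s=\theta(\delta_{S,S}(s))$. A pair $(\varphi,\sigma)\in\mathrm{Inj}(P,Q)\times\Sigma_X$ is intertwined if $\sigma\ell_p\sigma^{-1}=\ell_{\varphi(p)}$ for all $p\in P$. A fusion action system of $S$ on $X$ is a category whose objects are all subgroups of $S$, whose morphisms $P\to Q$ are intertwined pairs (composed componentwise), containing all $(c_s|_P,\ell_s)$ with $s\in S$, $sPs^{-1}\le Q$, and in which every morphism factors as an isomorphism of the category followed by an inclusion $(\mathrm{incl},\mathrm{id}_X)$. $\mathfrak{X}^\theta$ has, for $P,Q\in\mathrm{Ob}(\mathcal{T})$, $\mathfrak{X}^\theta(P,Q)=\{(c_{\mathfrak{g}},\theta(\mathfrak{g})):\mathfrak{g}\in\mathcal{T}(P,Q)\}$, and is regarded as a fusion action system of $S$ on $X$ by taking the one generated by these morphisms (allowing restrictions to subgroups not in $\mathrm{Ob}(\mathcal{T})$). $\mathcal{F}^\theta$ is its underlying fusion system, $\mathcal{F}^\theta(P,Q)=\{\varphi:\exists\sigma,(\varphi,\sigma)\in\mathfrak{X}^\theta(P,Q)\}$. Let $C=\{s\in S:\ell_s=\mathrm{id}_X\}$, $Z_S(P;X)=Z_S(P)\cap C$, $Z(P;X)=Z(P)\cap C$. $P\le S$ is $X$-centric if $Z(Q;X)=Z_S(Q;X)$ for all $Q$ $\mathcal{F}^\theta$-conjugate to $P$. An $X$-centric linking action system associated to a fusion action system $\mathfrak{X}$ is a category $\mathcal{L}$ whose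 objects are the $X$-centric subgroups of $S$, with functors $\mathcal{T}_S^{cX}\xrightarrow{\delta}\mathcal{L}\xrightarrow{\pi}\mathfrak{X}^{cX}$, where $\mathcal{T}_S^{cX}$ is $\mathcal{T}_S^{\mathcal{H}}(S)$ for $\mathcal{H}$ the set of $X$-centric subgroups and $\mathfrak{X}^{cX}$ is the full subcategory of $\mathfrak{X}$ on the $X$-centric subgroups; writing $\widehat s=\delta_{P,Q}(s)$ and $\pi(\mathfrak{g})=(c_{\mathfrak{g}},\ell_{\mathfrak{g}})$, it satisfies: (A) $\delta,\pi$ are the identity on objects, $\delta$ is injective and $\pi$ surjective on morphisms, $Z(P;X)$ acts (via $\delta$) freely on the right on $\mathcal{L}(P,Q)$, and $\pi_{P,Q}$ is the orbit map of this action; (B) for $p\in P$, $c_{\widehat p}=c_p$ and $\ell_{\widehat p}=\ell_p$; (C) for $\mathfrak{g}\in\mathcal{L}(P,Q)$ and $p\in P$, $\widehat{c_{\mathfrak{g}}(p)}\circ\mathfrak{g}=\mathfrak{g}\circ\widehat p$.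
   Formalization: The transporter system T is assumed to have finite morphism sets; without this the claim fails, e.g. for S = C_p acting regularly on X, T the transporter category of S * Z on {1, S} and θ killing Z, where E(1) ∩ K(1) has elements of infinite order. *)

(* Defs.v *)
From HB Require Import structures.
From mathcomp Require Import all_boot all_fingroup all_solvable.
From mathcomp Require Import boolp.

Set Implicit Arguments.
Unset Strict Implicit.
Unset Printing Implicit Defensive.

Local Open Scope group_scope.

(* Categories with finite hom-sets. [cmp g f] is g after f. *)
Record cat_class (O : Type) (hom : O -> O -> finType) := CatClass {
  cidm : forall P, hom P P;
  ccmp : forall P Q R, hom Q R -> hom P Q -> hom P R;
  ccmp1m : forall P Q (f : hom P Q), ccmp (cidm Q) f = f;
  ccmpm1 : forall P Q (f : hom P Q), ccmp f (cidm P) = f;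
  ccmpA : forall P Q R U (h : hom R U) (g : hom Q R) (f : hom P Q),
    ccmp h (ccmp g f) = ccmp (ccmp h g) f }.

Record category (O : Type) := Cat {
  hom :> O -> O -> finType;
  hom_class : cat_class hom }.

Definition idm O (C : category O) (P : O) : C P P := cidm (hom_class C) P.
Definition cmp O (C : category O) (P Q R : O) (g : C Q R) (f : C P Q) : C P R :=
  ccmp (hom_class C) g f.
Notation "g \co f" := (cmp g f) (at level 40, left associativity).

Lemma cmp1m O (C : category O) P Q (f : C P Q) : idm C Q \co f = f.
Proof. exact: ccmp1m. Qed.
Lemma cmpm1 O (C : category O) P Q (f : C P Q) : f \co idm C P = f.
Proof. exact: ccmpm1. Qed.
Lemma cmpA O (C : category O) P Q R U (h : C R U) (g : C Q R) (f : C P Q) :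
  h \co (g \co f) = h \co g \co f.
Proof. exact: ccmpA. Qed.

Definition inverses O (C : category O) P Q (f : C P Q) (g : C Q P) : bool :=
  (g \co f == idm C P) && (f \co g == idm C Q).

Definition is_iso O (C : category O) P Q (f : C P Q) : bool :=
  [exists g : C Q P, inverses f g].

Definition isomorphic O (C : category O) P Q : bool := [exists f : C P Q, is_iso f].

Definition minv O (C : category O) P Q (f : C P Q) (fI : is_iso f) : C Q P :=
  xchoose (existsP fI).

Lemma minvP O (C : category O) P Q (f : C P Q) (fI : is_iso f) :
  inverses f (minv fI).
Proof. exact: (xchooseP (existsP fI)). Qed.

Definition full_sub O O' (i : O' -> O) (C : category O) : category O' :=
  @Cat O' (fun P Q => C (i P) (i Q))
    (@CatClass O' (fun P Q => C (i P) (i Q)) (fun P => idm C (i P))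
       (fun P Q R => @cmp O C (i P) (i Q) (i R))
       (fun P Q => @cmp1m O C (i P) (i Q))
       (fun P Q => @cmpm1 O C (i P) (i Q))
       (fun P Q R U => @cmpA O C (i P) (i Q) (i R) (i U))).

(* A functor whose effect [Fo] on objects is prescribed. *)
Record functor O O' (C : category O) (D : category O') (Fo : O -> O') := Functor {
  fmap : forall P Q, C P Q -> D (Fo P) (Fo Q);
  fmap1 : forall P, fmap (idm C P) = idm D (Fo P);
  fmapM : forall P Q R (g : C Q R) (f : C P Q),
    fmap (g \co f) = fmap g \co fmap f }.

Section AutomorphismGroup.
Variables (O : Type) (C : category O) (P : O).

Record catAut := CatAut { aut_mor : C P P; aut_morP : is_iso aut_mor }.
HB.instance Definition _ := [isSub for aut_mor].
HB.instance Definition _ := [Finite of catAut by <:].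

Lemma idm_iso : is_iso (idm C P).
Proof. by apply/existsP; exists (idm C P); rewrite /inverses cmp1m eqxx. Qed.

Lemma cmp_iso (f g : C P P) : is_iso f -> is_iso g -> is_iso (f \co g).
Proof.
move=> /existsP[f' /andP[/eqP f1 /eqP f2]] /existsP[g' /andP[/eqP g1 /eqP g2]].
apply/existsP; exists (g' \co f'); apply/andP; split; apply/eqP.
  by rewrite cmpA -(cmpA g') f1 cmpm1.
by rewrite cmpA -(cmpA f) g2 cmpm1.
Qed.

Lemma minv_iso (f : C P P) (fI : is_iso f) : is_iso (minv fI).
Proof.
by apply/existsP; exists f; have /andP[h1 h2] := minvP fI; apply/andP; split.
Qed.

Definition aut1 : catAut := CatAut idm_iso.
Definition autM (f g : catAut) : catAut :=
  CatAut (cmp_iso (aut_morP f) (aut_morP g)).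
Definition autV (f : catAut) : catAut :=
  CatAut (minv_iso (aut_morP f)).

Lemma autMA : associative autM.
Proof. by move=> f g h; apply: val_inj; rewrite /= cmpA. Qed.
Lemma aut1M : left_id aut1 autM.
Proof. by move=> f; apply: val_inj; rewrite /= cmp1m. Qed.
Lemma autVM : left_inverse aut1 autV autM.
Proof.
by move=> f; apply: val_inj => /=; have /andP[/eqP] := minvP (aut_morP f).
Qed.

HB.instance Definition _ := Finite_isGroup.Build catAut autMA aut1M autVM.

End AutomorphismGroup.

Definition aut_ker O O' (C : category O) (D : category O') Fo (G : functor C D Fo) P :
    {set catAut C P} :=
  [set g | fmap G (val g) == idm D (Fo P)].

(* The p-group S is the whole of a finGroupType, so that N_S(P), Z_S(P) are
   'N(P), 'C(P). MathComp conjugates on the right: s x s^-1 is x ^ s^-1, and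
   s P s^-1 is P :^ s^-1. *)

Section Homomorphisms.
Variable S : finGroupType.
Implicit Types (P Q R : {group S}) (f g : {ffun S -> S}).

(* A homomorphism defined on P is encoded by its extension by 1 outside P, so
   that equality is Leibniz equality and an inclusion of P is [idf P]. *)
Definition inj_homs P Q : {set {ffun S -> S}} :=
  [set f : {ffun S -> S} | [&& morphic P f, dinjectiveb f P, f @: P \subset Q
             & 1.-support f \subset P]].

Definition idf P : {ffun S -> S} := [ffun x => if x \in P then x else 1].
Definition fcomp g f : {ffun S -> S} := [ffun x => g (f x)].
Definition conjf P (s : S) : {ffun S -> S} :=
  [ffun x => if x \in P then x ^ s^-1 else 1].

Definition transp P Q : {set S} := [set s | P :^ s^-1 \subset Q].

Definition autS P : {set {ffun S -> S}} := [set conjf P s | s in 'N(P)].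

Lemma inj_homsP P Q f :
  reflect [/\ {in P &, {morph f : x y / x * y}}, {in P &, injective f},
              forall x, x \in P -> f x \in Q & forall x, x \notin P -> f x = 1]
          (f \in inj_homs P Q).
Proof.
rewrite inE; apply: (iffP and4P) => [] [].
  move=> /morphicP fM /dinjectiveP fI /subsetP fQ /subsetP f1.
  split=> // x Px; first by apply: fQ; apply: imset_f.
  by apply/eqP; apply: contraNT Px => nf; apply: f1; rewrite inE.
move=> fM fI fQ f1; split; [exact/morphicP | exact/dinjectiveP | |].
  by apply/subsetP=> _ /imsetP[x Px ->]; apply: fQ.
by apply/subsetP=> x; rewrite inE; apply: contraR => /f1 ->.
Qed.

Lemma fcompA h g f : fcomp h (fcomp g f) = fcomp (fcomp h g) f.
Proof. by apply/ffunP=> x; rewrite !ffunE. Qed.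

Lemma inj_homs_1 P Q f : f \in inj_homs P Q -> f 1 = 1.
Proof.
case/inj_homsP=> fM _ _ _; apply: (mulgI (f 1)).
by rewrite -fM ?group1 // !mulg1.
Qed.

Lemma fcomp1f P Q f : f \in inj_homs P Q -> fcomp (idf Q) f = f.
Proof.
move=> fI; case/inj_homsP: (fI) => fM _ fQ f1; apply/ffunP=> x; rewrite !ffunE.
by have [/fQ -> //|/f1 ->] := boolP (x \in P); rewrite if_same.
Qed.

Lemma fcompf1 P Q f : f \in inj_homs P Q -> fcomp f (idf P) = f.
Proof.
move=> fI; case/inj_homsP: (fI) => _ _ _ f1; apply/ffunP=> x; rewrite !ffunE.
by case: ifPn => // /f1 ->; apply: inj_homs_1 fI.
Qed.

Lemma fcomp_inj P Q R g f :
  g \in inj_homs Q R -> f \in inj_homs P Q -> fcomp g f \in inj_homs P R.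
Proof.
move=> gI; have g1 := inj_homs_1 gI; case/inj_homsP: gI => gM gI gQ _.
case/inj_homsP=> fM fI fQ f1; apply/inj_homsP; split.
- by move=> x y Px Py; rewrite !ffunE fM // gM // fQ.
- by move=> x y Px Py; rewrite !ffunE => /gI e; apply: fI => //; apply: e; apply: fQ.
- by move=> x Px; rewrite ffunE gQ // fQ.
- by move=> x Px; rewrite ffunE f1.
Qed.

Lemma conjf1 P : conjf P 1 = idf P.
Proof. by apply/ffunP=> x; rewrite !ffunE invg1 conjg1. Qed.

Lemma transpP P Q s :
  reflect (forall x, x \in P -> x ^ s^-1 \in Q) (s \in transp P Q).
Proof.
rewrite inE; apply: (iffP subsetP) => h x.
  by move=> Px; apply: h; rewrite memJ_conjg.
by case/imsetP=> y Py ->; apply: h.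
Qed.

Lemma conjfM P Q s t :
  t \in transp P Q -> conjf P (s * t) = fcomp (conjf Q s) (conjf P t).
Proof.
move/transpP=> tP; apply/ffunP=> x; rewrite !ffunE invMg conjgM.
by case: ifPn => [/tP -> // | _]; rewrite group1 conj1g.
Qed.

Lemma norm_transp P s : s \in 'N(P) -> s \in transp P P.
Proof. by rewrite -groupV => sN; apply/transpP=> x Px; rewrite memJ_norm. Qed.

Lemma transp1 P Q : P \subset Q -> 1 \in transp P Q.
Proof. by rewrite inE invg1 conjsg1. Qed.

Lemma transpM P Q R s t :
  s \in transp Q R -> t \in transp P Q -> s * t \in transp P R.
Proof.
move=> /transpP sP /transpP tP; apply/transpP=> x Px.
by rewrite invMg conjgM; apply/sP/tP.
Qed.

Lemma conjf_inj P Q s : s \in transp P Q -> conjf P s \in inj_homs P Q.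
Proof.
move/transpP=> sP; apply/inj_homsP; split.
- by move=> x y Px Py; rewrite !ffunE (groupM Px Py) Px Py conjMg.
- by move=> x y Px Py; rewrite !ffunE Px Py; apply: conjg_inj.
- by move=> x Px; rewrite ffunE Px sP.
- by move=> x /negPf Px; rewrite ffunE Px.
Qed.

End Homomorphisms.

Definition sgr (S : finGroupType) (H : {set {group S}}) : Type :=
  {P : {group S} | P \in H}.
Definition Sgr S (H : {set {group S}}) (P : {group S}) (PH : P \in H) : sgr H :=
  exist _ P PH.
Definition sgr_val S (H : {set {group S}}) (P : sgr H) : {group S} := val P.
Coercion sgr_val : sgr >-> group_of.

Definition sgr_sub S (H K : {set {group S}}) (sHK : H \subset K) (P : sgr H) :
  sgr K := Sgr (subsetP sHK _ (valP P)).

(* The transporter category T_S^H(S). *)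
Section TransporterCategory.
Variables (S : finGroupType) (H : {set {group S}}).

Definition tr_hom (P Q : sgr H) : finType := {s : S | s \in transp P Q}.

Definition tr_class : cat_class tr_hom.
Proof.
pose i (P : sgr H) : tr_hom P P := exist _ 1 (transp1 (subxx (P : {group S}))).
pose c P Q R (s : tr_hom Q R) (t : tr_hom P Q) : tr_hom P R :=
  exist _ (val s * val t) (transpM (valP s) (valP t)).
exists i c.
- by move=> P Q f; apply: val_inj; rewrite /= mul1g.
- by move=> P Q f; apply: val_inj; rewrite /= mulg1.
- by move=> P Q R U h g f; apply: val_inj; rewrite /= mulgA.
Defined.

Definition trcat : category (sgr H) := Cat tr_class.

Definition tr_incl (P Q : sgr H) (sPQ : P \subset Q) : trcat P Q :=
  exist _ 1 (transp1 sPQ).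

End TransporterCategory.

Record fusion_system (S : finGroupType) := FusionSystem {
  fhom :> {group S} -> {group S} -> {set {ffun S -> S}};
  fhom_inj : forall P Q, fhom P Q \subset inj_homs P Q;
  fhom_cmp : forall P Q R g f,
    g \in fhom Q R -> f \in fhom P Q -> fcomp g f \in fhom P R;
  fhom_conj : forall P Q s, s \in transp P Q -> conjf P s \in fhom P Q;
  fhom_div : forall P Q f, f \in fhom P Q ->
    exists2 R : {group S}, R \subset Q & exists g h,
      [/\ g \in fhom P R, h \in fhom R P,
          fcomp h g = idf P, fcomp g h = idf R & f = fcomp (idf R) g] }.

Section FusionCategory.
Variables (S : finGroupType) (F : fusion_system S).
Implicit Types P Q R : {group S}.

Definition fcat_hom P Q : finType := {f : {ffun S -> S} | f \in F P Q}.

Lemma fhom_id P : idf P \in F P P.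
Proof. by rewrite -conjf1; apply/fhom_conj/transp1. Qed.

Definition fcat_class : cat_class fcat_hom.
Proof.
pose i P : fcat_hom P P := exist _ (idf P) (fhom_id P).
pose c P Q R (g : fcat_hom Q R) (f : fcat_hom P Q) : fcat_hom P R :=
  exist _ (fcomp (val g) (val f)) (fhom_cmp (valP g) (valP f)).
exists i c.
- move=> P Q f; apply: val_inj; rewrite /= (@fcomp1f _ P) //.
  exact: (subsetP (fhom_inj F P Q) _ (valP f)).
- move=> P Q f; apply: val_inj; rewrite /= (@fcompf1 _ _ Q) //.
  exact: (subsetP (fhom_inj F P Q) _ (valP f)).
- by move=> P Q R U h g f; apply: val_inj; rewrite /= fcompA.
Defined.

Definition fcat : category {group S} := Cat fcat_class.

Definition fconj P Q : bool := isomorphic fcat P Q.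

Definition fully_normalized P : Prop :=
  forall Q, fconj P Q -> #|'N(Q)| <= #|'N(P)|.
Definition fully_centralized P : Prop :=
  forall Q, fconj P Q -> #|'C(Q)| <= #|'C(P)|.

Definition AutS P : {set catAut fcat P} :=
  [set a : catAut fcat P | val (val a) \in autS P].

Definition Nphi_set P Q (phi : fcat P Q) (phiI : is_iso phi) : {set S} :=
  [set n in 'N(P) |
    fcomp (val phi) (fcomp (conjf P n) (val (minv phiI))) \in autS Q].

Lemma Nphi_group_set P Q (phi : fcat P Q) (phiI : is_iso phi) :
  group_set (Nphi_set phiI).
Proof.
have /andP[/eqP h1 /eqP h2] := minvP phiI.
have {h1} e1 : fcomp (val (minv phiI)) (val phi) = idf P.
  exact: (congr1 val h1).
have {h2} e2 : fcomp (val phi) (val (minv phiI)) = idf Q.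
  exact: (congr1 val h2).
have ih : val (minv phiI) \in inj_homs Q P.
  exact: (subsetP (fhom_inj F Q P) _ (valP (minv phiI))).
apply/group_setP; split=> [|n m].
  rewrite inE group1 conjf1 (fcomp1f ih) e2 -conjf1 /=.
  by apply: imset_f; apply: group1.
rewrite inE => /andP[nN /imsetP[s sN es]].
rewrite inE => /andP[mN /imsetP[t tN et]].
rewrite inE groupM //= (@conjfM _ P P n m (norm_transp mN)).
apply/imsetP; exists (s * t); first by rewrite groupM.
rewrite (@conjfM _ Q Q s t (norm_transp tN)) -es -et.
rewrite -!fcompA (fcompA (val (minv phiI))) e1 (fcompA (idf P)).
by rewrite (@fcomp1f _ P P) // conjf_inj // norm_transp.
Qed.

Definition Nphi P Q (phi : fcat P Q) (phiI : is_iso phi) : {group S} :=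
  Group (Nphi_group_set phiI).

Definition saturated (p : nat) : Prop :=
  (forall P, fully_normalized P ->
     fully_centralized P /\ p.-Sylow([set: catAut fcat P]) (AutS P)) /\
  (forall P Q (phi : fcat P Q) (phiI : is_iso phi), fully_centralized Q ->
     exists phit : fcat (Nphi phiI) [set: S]%G,
       {in P, val phit =1 val phi}).

End FusionCategory.

(* The image of R (a subset of N_S(P)) under delta_{P,P}, in the automorphism
   group of P. *)
Definition hat (S : finGroupType) (H : {set {group S}}) (C : category (sgr H))
    (delta : functor (trcat H) C id) (P : sgr H) (R : {set S}) :
    {set catAut C P} :=
  [set g | [exists s : trcat H P P,
              (val s \in R) && (fmap delta s == val g)]].

Record transporter_system (p : nat) (S : finGroupType) (F : fusion_system S) :=
  TransporterSystem {
  tr_ob : {set {group S}};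
  tr_obS : [set: S]%G \in tr_ob;
  tr_ob_conj : forall P Q, P \in tr_ob -> fconj F P Q -> Q \in tr_ob;
  tr_ob_over : forall P Q : {group S},
    P \in tr_ob -> P \subset Q -> Q \in tr_ob;
  tr_cat :> category (sgr tr_ob);
  tr_delta : functor (trcat tr_ob) tr_cat id;
  tr_pi : functor tr_cat (fcat F) (@sgr_val S tr_ob);
  tr_freer : forall P Q (g : tr_cat P Q) (e : catAut tr_cat P),
    e \in aut_ker tr_pi P -> g \co val e = g -> e = 1;
  tr_freel : forall P Q (g : tr_cat P Q) (e : catAut tr_cat Q),
    e \in aut_ker tr_pi Q -> val e \co g = g -> e = 1;
  tr_pi_surj : forall (P Q : sgr tr_ob) (f : fcat F P Q),
    exists g : tr_cat P Q, fmap tr_pi g = f;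
  tr_pi_orbit : forall P Q (g g' : tr_cat P Q),
    fmap tr_pi g = fmap tr_pi g' <->
    exists2 e : catAut tr_cat P, e \in aut_ker tr_pi P & g' = g \co val e;
  tr_delta_inj : forall P Q, injective (@fmap _ _ _ _ _ tr_delta P Q);
  tr_conj : forall P Q (s : trcat tr_ob P Q),
    val (fmap tr_pi (fmap tr_delta s)) = conjf P (val s);
  tr_equiv : forall P Q (g : tr_cat P Q)
      (x : trcat tr_ob P P) (y : trcat tr_ob Q Q),
    val x \in P -> val y = val (fmap tr_pi g) (val x) ->
    fmap tr_delta y \co g = g \co fmap tr_delta x;
  tr_Sylow : let top : sgr tr_ob := Sgr tr_obS in
    p.-Sylow([set: catAut tr_cat top]) (hat tr_delta top setT);
  tr_ext : forall (P Q Pt Qt : sgr tr_ob) (g : tr_cat P Q) (g' : tr_cat Q P)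
      (nP : P <| Pt) (nQ : Q <| Qt),
    inverses g g' ->
    (forall x : trcat tr_ob P P, val x \in Pt ->
       exists2 y : trcat tr_ob Q Q, val y \in Qt
         & g \co fmap tr_delta x \co g' = fmap tr_delta y) ->
    exists gt : tr_cat Pt Qt,
      gt \co fmap tr_delta (tr_incl (normal_sub nP)) =
      fmap tr_delta (tr_incl (normal_sub nQ)) \co g }.

(* The product s * t of permutations in MathComp applies s first; hence the
   reversal of factors in the next two records and in [pcomp], and the
   identity  l ^ sigma = sigma o l o sigma^-1  used in [intertwined]. *)
Record laction (S : finGroupType) (X : finType) := LAction {
  lact :> S -> {perm X};
  lactM : forall s t, lact (s * t) = lact t * lact s }.

Record sym_rep p S (F : fusion_system S) (T : transporter_system p F)
    (X : finType) := SymRep {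
  srep : forall P Q, T P Q -> {perm X};
  srepM : forall P Q R (g : T Q R) (f : T P Q),
    srep (g \co f) = srep f * srep g;
  srep_incl : forall (P Q : sgr (tr_ob T)) (sPQ : P \subset Q),
    srep (fmap (tr_delta T) (tr_incl sPQ)) = 1 }.

Section FusionActionSystems.
Variables (S : finGroupType) (X : finType) (l : laction S X).
Implicit Types P Q R : {group S}.

Definition fpair : finType := ({ffun S -> S} * {perm X})%type.

Definition pcomp (g f : fpair) : fpair := (fcomp g.1 f.1, f.2 * g.2).
Definition pid P : fpair := (idf P, 1).

Definition intertwined P Q : {set fpair} :=
  [set f | (f.1 \in inj_homs P Q) &&
           [forall s in P, l s ^ f.2 == l (f.1 s)]].

Lemma intwP P Q f :
  reflect (f.1 \in inj_homs P Q /\ {in P, forall s, l s ^ f.2 = l (f.1 s)})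
          (f \in intertwined P Q).
Proof.
rewrite [X in reflect _ X]in_set; apply: (iffP andP) => -[fI fl]; split=> //.
  by move=> s /(forall_inP fl)/eqP.
by apply/forall_inP=> s /fl/eqP.
Qed.

Record fusion_action_system := FusionActionSystem {
  xhom :> {group S} -> {group S} -> {set fpair};
  xhom_intw : forall P Q, xhom P Q \subset intertwined P Q;
  xhom_cmp : forall P Q R g f,
    g \in xhom Q R -> f \in xhom P Q -> pcomp g f \in xhom P R;
  xhom_conj : forall P Q s, s \in transp P Q -> (conjf P s, l s) \in xhom P Q;
  xhom_div : forall P Q f, f \in xhom P Q ->
    exists2 R : {group S}, R \subset Q & exists g h,
      [/\ g \in xhom P R, h \in xhom R P,
          pcomp h g = pid P, pcomp g h = pid R & f = pcomp (pid R) g] }.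

Lemma lact1 : l 1 = 1.
Proof. by apply: (mulgI (l 1)); rewrite -lactM !mulg1. Qed.

Lemma intertwined_cmp P Q R g f :
  g \in intertwined Q R -> f \in intertwined P Q -> pcomp g f \in intertwined P R.
Proof.
move=> /intwP[gI gl] /intwP[fI fl]; apply/intwP; split=> [|s Ps].
  exact: fcomp_inj gI fI.
case/inj_homsP: fI => _ _ fQ _.
by rewrite /= conjgM fl // gl ?fQ // ffunE.
Qed.

Lemma intertwined_conj P Q s :
  s \in transp P Q -> (conjf P s, l s) \in intertwined P Q.
Proof.
move=> sP; apply/intwP; split=> [|x Px] /=; first exact: conjf_inj.
have lV : l s^-1 = (l s)^-1.
  by apply: (mulgI (l s)); rewrite -lactM mulVg lact1 mulgV.
by rewrite ffunE Px !conjgE invgK !lactM lV mulgA.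
Qed.

Lemma intertwined_div P Q f : f \in intertwined P Q ->
  exists2 R : {group S}, R \subset Q & exists g h,
    [/\ g \in intertwined P R, h \in intertwined R P,
        pcomp h g = pid P, pcomp g h = pid R & f = pcomp (pid R) g].
Proof.
case: f => f sg /intwP[/= fI fl].
have f_1 := inj_homs_1 fI; case/inj_homsP: (fI) => fM finj fQ f1.
pose R : {group S} := (Morphism fM @* P)%G.
have RE x : reflect (exists2 y, y \in P & x = f y) (x \in R).
  by rewrite /= /morphim setIid; apply: (iffP imsetP).
pose h : {ffun S -> S} :=
  [ffun x => if [pick y in P | f y == x] is Some y then y else 1].
have hf y : y \in P -> h (f y) = y.
  move=> Py; rewrite ffunE; case: pickP => [z /andP[Pz /eqP /finj ->] //|].
  by move/(_ y); rewrite Py eqxx.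
have h0 x : x \notin R -> h x = 1.
  move=> Rx; rewrite ffunE; case: pickP => // z /andP[Pz /eqP e].
  by case/negP: Rx; apply/RE; exists z.
have fR : f \in inj_homs P R.
  by apply/inj_homsP; split=> // x Px; apply/RE; exists x.
have hP : h \in inj_homs R P.
  apply/inj_homsP; split=> //.
  - by move=> _ _ /RE[x Px ->] /RE[y Py ->]; rewrite -fM // !hf // groupM.
  - by move=> _ _ /RE[x Px ->] /RE[y Py ->]; rewrite !hf // => ->.
  - by move=> _ /RE[x Px ->]; rewrite hf.
exists R; first by apply/subsetP=> _ /RE[x Px ->]; apply: fQ.
exists (f, sg), (h, sg^-1); split.
- exact/intwP.
- apply/intwP; split=> // _ /RE[x Px ->] /=.
  by rewrite hf // -fl // conjgK.
- rewrite /pcomp /pid /= mulgV; congr (_, _); apply/ffunP=> x.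
  rewrite [LHS]ffunE [RHS]ffunE.
  by case: ifPn => [/hf //|/f1 ->]; rewrite -[X in h X]f_1 hf.
- rewrite /pcomp /pid /= mulVg; congr (_, _); apply/ffunP=> x.
  rewrite [LHS]ffunE [RHS]ffunE.
  by case: ifPn => [/RE[y Py ->]|/h0 -> //]; rewrite hf.
- by rewrite /pcomp /pid /= mulg1 (fcomp1f fR).
Qed.

(* The intersection of all fusion action systems containing the pairs in M.
   The first conjunct matters only when M contains a pair that is not
   intertwined, in which case there are no such systems; the generators used
   below are intertwined by [theta_gen_intertwined]. *)
Definition gen_hom (M : {group S} -> {group S} -> fpair -> Prop) P Q :
    {set fpair} :=
  [set f in intertwined P Q |
    `[< forall Y : fusion_action_system,
          (forall P' Q' f', M P' Q' f' -> f' \in Y P' Q') -> f \in Y P Q >]].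

Lemma gen_homP M P Q f :
  reflect (f \in intertwined P Q /\ forall Y : fusion_action_system,
             (forall P' Q' f', M P' Q' f' -> f' \in Y P' Q') -> f \in Y P Q)
          (f \in gen_hom M P Q).
Proof.
have -> : (f \in gen_hom M P Q) = (f \in intertwined P Q) &&
    `[< forall Y : fusion_action_system,
          (forall P' Q' f', M P' Q' f' -> f' \in Y P' Q') -> f \in Y P Q >].
  by rewrite inE.
by apply: (iffP andP) => -[fI fM]; split=> //; apply/asboolP.
Qed.

Lemma gen_hom_div M P Q f : f \in gen_hom M P Q ->
  exists2 R : {group S}, R \subset Q & exists g h,
    [/\ g \in gen_hom M P R, h \in gen_hom M R P,
        pcomp h g = pid P, pcomp g h = pid R & f = pcomp (pid R) g].
Proof.
move=> /gen_homP[fI fM].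
have [R sRQ [g [h [gI hI hg gh ef]]]] := intertwined_div fI.
have pid_l U V (k : fpair) : k \in intertwined U V -> pcomp (pid V) k = k.
  by case: k => k s /intwP[kI _]; rewrite /pcomp /= mulg1 (fcomp1f kI).
have pid_r U V (k : fpair) : k \in intertwined U V -> pcomp k (pid U) = k.
  by case: k => k s /intwP[kI _]; rewrite /pcomp /= mul1g (fcompf1 kI).
have pA (a b c : fpair) : pcomp a (pcomp b c) = pcomp (pcomp a b) c.
  by rewrite /pcomp /= fcompA mulgA.
have codom U V k k' : k \in intertwined U V -> k' \in intertwined V U ->
    pcomp k k' = pid V -> V = k.1 @: U :> {set S}.
  move=> /intwP[/inj_homsP[_ _ kV _] _] /intwP[/inj_homsP[_ _ kU _] _].
  move=> [/ffunP e _]; apply/setP=> x; apply/idP/imsetP=> [Vx|[y Uy ->]].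
    by exists (k'.1 x); [exact: kU | have := e x; rewrite !ffunE Vx].
  exact: kV.
have key Y : (forall P' Q' f', M P' Q' f' -> f' \in xhom Y P' Q') ->
    g \in Y P R /\ h \in Y R P.
  move=> /fM /xhom_div[R' _ [g' [h' [gY hY hg' gh' ef']]]].
  have gI' := subsetP (xhom_intw Y P R') _ gY.
  have hI' := subsetP (xhom_intw Y R' P) _ hY.
  have egg : g = g' by rewrite -(pid_l _ _ _ gI) -ef ef' (pid_l _ _ _ gI').
  have eRR : R = R'.
    apply: group_inj.
    by rewrite (codom _ _ _ _ gI hI gh) (codom _ _ _ _ gI' hI' gh') egg.
  rewrite -eRR -egg in gY hY hI' hg'; split=> //.
  by rewrite -(pid_l _ _ _ hI) -hg' -pA gh (pid_r _ _ _ hI').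
exists R => //; exists g, h; split=> //.
  by apply/gen_homP; split=> // Y /key[].
by apply/gen_homP; split=> // Y /key[].
Qed.

Definition generated (M : {group S} -> {group S} -> fpair -> Prop) :
  fusion_action_system.
Proof.
exists (gen_hom M).
- by move=> P Q; apply/subsetP=> f /gen_homP[].
- move=> P Q R g f /gen_homP[gI gM] /gen_homP[fI fM]; apply/gen_homP.
  split=> [|Y MY]; first exact: intertwined_cmp gI fI.
  exact: xhom_cmp (gM Y MY) (fM Y MY).
- move=> P Q s sP; apply/gen_homP; split=> [|Y _]; last exact: xhom_conj.
  exact: intertwined_conj.
- by move=> P Q f; apply: gen_hom_div.
Defined.

Variable XX : fusion_action_system.

Definition xcat_hom P Q : finType := {f : fpair | f \in XX P Q}.

Lemma xhom_id P : pid P \in XX P P.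
Proof. by rewrite /pid -conjf1 -lact1; apply/xhom_conj/transp1. Qed.

Definition xcat_class : cat_class xcat_hom.
Proof.
pose i P : xcat_hom P P := exist _ (pid P) (xhom_id P).
pose c P Q R (g : xcat_hom Q R) (f : xcat_hom P Q) : xcat_hom P R :=
  exist _ (pcomp (val g) (val f)) (xhom_cmp (valP g) (valP f)).
exists i c.
- move=> P Q [[f s] h]; apply: val_inj; rewrite /= /pcomp /= mulg1.
  by case/intwP: (subsetP (xhom_intw XX P Q) _ h) => fI _; rewrite (fcomp1f fI).
- move=> P Q [[f s] h]; apply: val_inj; rewrite /= /pcomp /= mul1g.
  by case/intwP: (subsetP (xhom_intw XX P Q) _ h) => fI _; rewrite (fcompf1 fI).
- by move=> P Q R U h g f; apply: val_inj; rewrite /= /pcomp /= fcompA mulgA.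
Defined.

Definition xcat : category {group S} := Cat xcat_class.

Definition underlying : fusion_system S.
Proof.
exists (fun P Q => [set f.1 | f in XX P Q]).
- move=> P Q; apply/subsetP=> _ /imsetP[f /(subsetP (xhom_intw XX P Q)) + ->].
  by case/intwP.
- move=> P Q R _ _ /imsetP[g gX ->] /imsetP[f fX ->].
  by apply/imsetP; exists (pcomp g f) => //; apply: xhom_cmp gX fX.
- by move=> P Q s /(xhom_conj XX) sX; apply/imsetP; exists (conjf P s, l s).
- move=> P Q _ /imsetP[f /xhom_div[R sR [g [h [gX hX hg gh ->]]]] ->].
  exists R => //; exists g.1, h.1; split=> //; try exact: imset_f.
    by case: hg.
  by case: gh.
Defined.

Definition lact_ker : {set S} := [set s | l s == 1].
Definition ZSX P : {set S} := 'C(P) :&: lact_ker.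
Definition ZX P : {set S} := 'Z(P) :&: lact_ker.

Definition Xcentric : {set {group S}} :=
  [set P | [forall Q, fconj underlying P Q ==> (ZX Q == ZSX Q)]].

Record linking_action_system (L : category (sgr Xcentric))
    (delta : functor (trcat Xcentric) L id)
    (pi : functor L (full_sub (@sgr_val S Xcentric) xcat) id) : Prop :=
  LinkingActionSystem {
  lk_delta_inj : forall (P Q : sgr Xcentric), injective (@fmap _ _ _ _ _ delta P Q);
  lk_pi_surj : forall (P Q : sgr Xcentric) (f : xcat P Q),
    exists g : L P Q, fmap pi g = f;
  lk_free : forall (P Q : sgr Xcentric) (g : L P Q) (z : trcat Xcentric P P),
    val z \in ZX P -> g \co fmap delta z = g -> val z = 1;
  lk_pi_orbit : forall (P Q : sgr Xcentric) (g g' : L P Q),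
    fmap pi g = fmap pi g' <->
    exists2 z : trcat Xcentric P P,
      val z \in ZX P & g' = g \co fmap delta z;
  lk_conj : forall (P : sgr Xcentric) (x : trcat Xcentric P P), val x \in P ->
    val (fmap pi (fmap delta x)) = (conjf P (val x), l (val x));
  lk_equiv : forall (P Q : sgr Xcentric) (g : L P Q)
      (x : trcat Xcentric P P) (y : trcat Xcentric Q Q),
    val x \in P -> val y = (val (fmap pi g)).1 (val x) ->
    fmap delta y \co g = g \co fmap delta x }.

End FusionActionSystems.

Section ThetaSystem.
Variables (p : nat) (S : finGroupType) (F : fusion_system S).
Variables (T : transporter_system p F) (X : finType) (theta : sym_rep T X).

Definition tr_top : sgr (tr_ob T) := Sgr (tr_obS T).

Definition hatS (s : S) : T tr_top tr_top :=
  fmap (tr_delta T)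
    (exist _ s (norm_transp (subsetP (normG [set: S]%G) s (in_setT s)))
      : trcat (tr_ob T) tr_top tr_top).

Lemma theta_lactM s t : srep theta (hatS (s * t)) = srep theta (hatS t) * srep theta (hatS s).
Proof.
rewrite -srepM; congr (srep theta _); rewrite /hatS.
apply: etrans (fmapM (tr_delta T) _ _); apply: (congr1 (fun x => fmap (tr_delta T) x)).
exact: val_inj.
Qed.

Definition theta_action : laction S X := LAction theta_lactM.

Definition theta_gen (P Q : {group S}) (f : fpair S X) : Prop :=
  exists (P' Q' : sgr (tr_ob T)) (g : T P' Q'),
    [/\ P = P', Q = Q' & f = (val (fmap (tr_pi T) g), srep theta g)].

Lemma srep_delta (P Q : sgr (tr_ob T)) (s : trcat (tr_ob T) P Q) :
  srep theta (fmap (tr_delta T) s) = theta_action (val s).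
Proof.
pose iP := tr_incl (subsetT P : (P : {group S}) \subset tr_top).
pose iQ := tr_incl (subsetT Q : (Q : {group S}) \subset tr_top).
have hS := norm_transp (subsetP (normG [set: S]%G) (val s) (in_setT _)).
have e : iQ \co s = (exist _ (val s) hS : trcat _ tr_top tr_top) \co iP.
  by apply: val_inj; rewrite /= mul1g mulg1.
have := congr1 (fun x => srep theta (fmap (tr_delta T) x)) e.
rewrite (fmapM (tr_delta T) iQ) srepM srep_incl mulg1 => ->.
rewrite (fmapM (tr_delta T) _ iP) srepM srep_incl mul1g /= /hatS.
by congr (srep theta _); apply: (congr1 (fun x => fmap (tr_delta T) x));
   apply: val_inj.
Qed.

Lemma theta_gen_intertwined (P Q : {group S}) f :
  theta_gen P Q f -> f \in intertwined theta_action P Q.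
Proof.
case=> P' [Q' [g [-> -> ->]]]; apply/intwP => /=.
have gI := subsetP (fhom_inj F P' Q') _ (valP (fmap (tr_pi T) g)).
split=> // s Ps; have sP := norm_transp (subsetP (normG P') s Ps).
case/inj_homsP: gI => _ _ gQ _.
have tQ := norm_transp (subsetP (normG Q') _ (gQ s Ps)).
pose x : trcat (tr_ob T) P' P' := exist _ s sP.
pose y : trcat (tr_ob T) Q' Q' :=
  exist (fun z => z \in transp Q' Q') _ tQ.
have := congr1 (fun h => srep theta h) (@tr_equiv _ _ _ T P' Q' g x y Ps erefl).
rewrite !srepM !srep_delta => /= e.
by rewrite -[srep theta (hatS s)]/(theta_action s) conjgE -e mulKg.
Qed.

Definition Xtheta : fusion_action_system theta_action :=
  generated theta_action theta_gen.

(* The morphism c_g of F^theta attached to g is the morphism c_g of F, so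
   ker [T(P) -> F^theta(P)] is computed with the projection to F. *)
Definition Eker (P : sgr (tr_ob T)) : {set catAut T P} := aut_ker (tr_pi T) P.

Definition Kker (P : sgr (tr_ob T)) : {set catAut T P} :=
  [set g | srep theta (val g) == 1].

End ThetaSystem.

(* Orbits of the right action of a group A of automorphisms of P on C(P, Q). *)
Section Quotient.
Variables (O : Type) (C : category O) (P Q : O) (A : {set catAut C P}).

Definition rorbit (g : C P Q) : {set C P Q} := [set g \co val a | a in A].

Definition quot_hom : finType :=
  {B : {set C P Q} | B \in [set rorbit g | g in [set: C P Q]]}.

Definition quot_class (g : C P Q) : quot_hom :=
  exist _ (rorbit g) (imset_f rorbit (in_setT g)).

End Quotient.

(* Main.v *)
Require Import Defs.
From mathcomp Require Import all_boot all_fingroup all_solvable.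
From mathcomp Require Import boolp.

(** Write D(P) for the intersection of E(P) and K(P). An element of E(P) induces
the identity on P, so axiom (C) puts the image of Z(P;X) in the centre of D(P).
The first half of the theorem therefore amounts to this image being a Sylow
p-subgroup of D(P) ([hatZ_Sylow]): by Schur-Zassenhaus a central Sylow
p-subgroup is a direct factor ([central_Sylow_dprod]), and any p'-group
complementing it must consist of all p'-elements ([dprod_p'_eltE]), which gives
both the uniqueness and the description of EK'(P).

To see that the image is Sylow, move P by an isomorphism of T to some Q for
which the image of N_S(Q) is Sylow in T(Q) ([Sylow_conjugate]). Axioms (I) and
(II) give such a Q, by induction on the index in S: if Q has a normalizer of
maximal order among the conjugates of P and the image of N_S(Q) were not Sylow,
then a p-element outside of it normalizing it would extend to N_S(Q), could be
realized by an element of S after a further isomorphism, and would enlarge the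
normalizer.
Now a p-element of D(P) corresponds to one of D(Q), which is conjugate to the
image of some s in N_S(Q). Being in D(Q) means that s lies in Z_S(Q;X), which
is Z(Q;X) as P is X-centric; so s is in Q, and axiom (C) carries it back to an
element of P. Here X-centricity of P is used along isomorphisms of T, which are
isomorphisms of F^theta ([Xcentric_iso]).

For the quotient category, let g be in T(P,Q) and b in EK'(Q). Then b g = g a
for some a in D(P), and since E(P) acts freely the order of a divides that of b;
hence a is in EK'(P) ([EK'_push]), and composition is well defined on the orbits
of the groups EK'(P). Two morphisms of T(P,Q) have the same image in X^theta
exactly when they differ by an element of D(P), so after division by EK'(P) the
fibres are orbits of Z(P;X) ([linking_orbit]); these act freely because Z(P;X)
is a p-group and EK'(P) a p'-group ([EK'_hat1]). It remains to know that
generating X^theta creates no morphism between objects of T other than the pairs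
coming from T ([Xtheta_lift]): those pairs, together with all intertwined
morphisms of F starting at the remaining subgroups, already form a fusion action
system ([lifted_system]). *)

Set Implicit Arguments.
Unset Strict Implicit.
Unset Printing Implicit Defensive.

Local Open Scope group_scope.

Local Notation idm := Defs.idm.
Local Notation pcomp := Defs.pcomp.
Local Notation pid := Defs.pid.

(** * Central Sylow subgroups *)

Section CentralSylow.
Variables (gT : finGroupType) (p : nat).
Implicit Types G Z A : {group gT}.

Lemma p_elt_pgroup pi G : {in G, forall x, pi.-elt x} -> pi.-group G.
Proof.
move=> piG; apply/pgroupP=> q q_pr /(Cauchy q_pr)[x Gx ox].
by have := piG x Gx; rewrite /p_elt ox pnatE.
Qed.

Lemma dprod_p'_Hall G Z A :
  p.-group Z -> p^'.-group A -> Z \x A = G -> p^'.-Hall(G) A.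
Proof.
move=> pZ p'A defG; have [_ /normal_sub sAG] := dprod_normal2 defG.
rewrite pHallE sAG -(dprod_card defG) partnM // part_p'nat ?mul1n ?part_pnat_id //.
  by rewrite eqxx.
by rewrite pnatNK.
Qed.

(** A normal Hall subgroup contains every element of the right order; in
particular the p'-factor A does not depend on any choice. *)
Lemma dprod_p'_eltE G Z A : p.-group Z -> p^'.-group A -> Z \x A = G ->
  A = [set x in G | p^'.-elt x] :> {set gT}.
Proof.
move=> pZ p'A defG; have hallA := dprod_p'_Hall pZ p'A defG.
have [_ nsAG] := dprod_normal2 defG.
apply/setP=> x; rewrite inE; apply/idP/andP=> [Ax|[Gx]].
  by rewrite (subsetP (normal_sub nsAG)) // (mem_p_elt p'A).
by rewrite (mem_normal_Hall hallA).
Qed.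

(** The complement given by Schur-Zassenhaus centralizes Z, hence is normal and
equal to the p'-core. *)
Lemma central_Sylow_dprod G Z :
  p.-Sylow(G) Z -> Z \subset 'C(G) -> Z \x 'O_p^'(G) = G.
Proof.
move=> sylZ cZG; have nsZ : Z <| G.
  by rewrite /normal (pHall_sub sylZ) cents_norm // centsC.
have /splitsP[K /complP[tiZK defG]] := SchurZassenhaus_split (pHall_Hall sylZ) nsZ.
have sKG : K \subset G by rewrite -defG mulG_subr.
have cKZ : K \subset 'C(Z) by rewrite centsC (subset_trans cZG) ?centS.
have dG : Z \x K = G by rewrite dprodE.
have p'K : p^'.-group K.
  have := card_Hall sylZ; rewrite -(dprod_card dG) => e.
  have/eqP: (#|Z| * 1 = #|Z| * #|K|`_p)%N.
    rewrite muln1 [LHS]e partnM // part_pnat_id //; exact: pHall_pgroup sylZ.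
  rewrite eqn_pmul2l // eq_sym => /eqP e1.
  by rewrite /pgroup -[X in _.-nat X](partnC p (cardG_gt0 K)) e1 mul1n part_pnat.
have [_ nsK] := dprod_normal2 dG.
by rewrite (normal_Hall_pcore (dprod_p'_Hall (pHall_pgroup sylZ) p'K dG) nsK).
Qed.

End CentralSylow.

(** * Isomorphisms in a category *)

Lemma inversesP O (C : category O) P Q (f : C P Q) (g : C Q P) :
  reflect (g \co f = idm C P /\ f \co g = idm C Q) (inverses f g).
Proof. by apply: (iffP andP) => -[/eqP ? /eqP ?]. Qed.

Lemma inverses_sym O (C : category O) P Q (f : C P Q) (g : C Q P) :
  inverses f g -> inverses g f.
Proof. by rewrite /inverses andbC. Qed.

Lemma inverses_cmp O (C : category O) P Q R (f : C P Q) f' (g : C Q R) g' :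
  inverses f f' -> inverses g g' -> inverses (g \co f) (f' \co g').
Proof.
move=> /inversesP[f1 f2] /inversesP[g1 g2]; apply/inversesP; split.
  by rewrite cmpA -(cmpA f') g1 cmpm1.
by rewrite cmpA -(cmpA g) f2 cmpm1.
Qed.

Lemma inverses_aut O (C : category O) P (f f' : C P P) :
  inverses f f' -> exists a : catAut C P, val a = f.
Proof. by move=> ff'; exists (CatAut (introT existsP (ex_intro _ f' ff'))). Qed.

Lemma aut_inverses O (C : category O) P (a : catAut C P) :
  inverses (val a) (val a^-1).
Proof. exact: minvP. Qed.

Lemma val_autM O (C : category O) P (a b : catAut C P) :
  val (a * b) = val a \co val b.
Proof. by []. Qed.

Lemma val_aut1 O (C : category O) P : val (1 : catAut C P) = idm C P.
Proof. by []. Qed.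

Lemma split_inverses O (C : category O) P Q (f : C P Q) (g h : C Q P) :
  g \co f = idm C P -> f \co h = idm C Q -> inverses f g.
Proof.
move=> gf fh; apply/inversesP; split=> //.
have -> // : g = h.
by rewrite -(cmpm1 g) -fh cmpA gf cmp1m.
Qed.

(** Used to compare the orders of a and b whenever g intertwines them. *)
Lemma cmp_expgn O (C : category O) P Q (g : C P Q)
    (b : catAut C Q) (a : catAut C P) n :
  val b \co g = g \co val a -> val (b ^+ n) \co g = g \co val (a ^+ n).
Proof.
move=> ba; elim: n => [|n IHn]; first by rewrite !expg0 !val_aut1 cmp1m cmpm1.
by rewrite !expgS !val_autM -cmpA IHn cmpA ba cmpA.
Qed.

(** * Morphisms of a fusion system *)

Section Fusion.
Variables (S : finGroupType) (F : fusion_system S).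
Implicit Types P Q R : {group S}.

Lemma inj_homs_in P Q f x : f \in inj_homs P Q -> x \in P -> f x \in Q.
Proof. by case/inj_homsP=> _ _ + _; apply. Qed.

Lemma fhom_injs P Q f : f \in F P Q -> f \in inj_homs P Q.
Proof. exact: (subsetP (fhom_inj F P Q)). Qed.

(** Divisibility of F, with the intermediate subgroup identified as the image. *)
Lemma fhom_image P Q f : f \in F P Q ->
  exists2 R : {group S}, R \subset Q & R = f @: P :> {set S} /\
    f \in F P R /\ exists2 h, h \in F R P & fcomp h f = idf P /\ fcomp f h = idf R.
Proof.
case/fhom_div=> R sRQ [g [h [gR hP hg gh ->]]]; exists R => //.
have gI := fhom_injs gR; have hI := fhom_injs hP.
rewrite (fcomp1f gI); split; last by split=> //; exists h.
case/inj_homsP: gI => _ _ gPR _; case/inj_homsP: hI => _ _ hRP _.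
apply/setP=> x; apply/idP/imsetP=> [Rx|[y Py ->]]; last exact: gPR.
exists (h x); first exact: hRP.
by have /ffunP/(_ x) := gh; rewrite !ffunE Rx.
Qed.

Lemma fhom_codom P Q Q' f :
  f \in F P Q -> {in P, forall x, f x \in Q'} -> f \in F P Q'.
Proof.
move=> fF fQ'; have [R _ [eR [fR _]]] := fhom_image fF.
have sRQ' : R \subset Q'.
  by rewrite eR; apply/subsetP=> _ /imsetP[x Px ->]; apply: fQ'.
have := fhom_cmp (fhom_conj F (transp1 sRQ')) fR.
by rewrite conjf1 (fcomp1f (fhom_injs fR)).
Qed.

Lemma fconj_inv P R f h : f \in F P R -> h \in F R P ->
  fcomp h f = idf P -> fcomp f h = idf R -> fconj F P R.
Proof.
move=> fF hF hf fh; apply/existsP; exists (exist _ f fF : fcat F P R).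
apply/existsP; exists (exist _ h hF : fcat F R P).
by apply/inversesP; split; apply: val_inj.
Qed.

End Fusion.

(** * Transporter systems *)

Section Transporter.
Variables (p : nat) (S : finGroupType) (F : fusion_system S).
Variable T : transporter_system p F.
Local Notation Ob := (tr_ob T).
Implicit Types P Q R : sgr Ob.

(** The homomorphism c_g of the morphism g. *)
Definition conjm P Q (g : T P Q) : {ffun S -> S} := val (fmap (tr_pi T) g).
Definition hatm P Q (s : trcat Ob P Q) : T P Q := fmap (tr_delta T) s.

Lemma conjm_fhom P Q (g : T P Q) : conjm g \in F P Q.
Proof. exact: (valP (fmap (tr_pi T) g)). Qed.

Lemma conjm_injs P Q (g : T P Q) : conjm g \in inj_homs P Q.
Proof. exact: fhom_injs (conjm_fhom g). Qed.

Lemma conjm_in P Q (g : T P Q) x : x \in P -> conjm g x \in Q.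
Proof. exact: inj_homs_in (conjm_injs g). Qed.

Lemma conjm_id P : conjm (idm T P) = idf P.
Proof. by rewrite /conjm fmap1. Qed.

Lemma conjmM P Q R (g : T Q R) (f : T P Q) : conjm (g \co f) = fcomp (conjm g) (conjm f).
Proof. by rewrite /conjm fmapM. Qed.

Lemma conjm_hatm P Q (s : trcat Ob P Q) : conjm (hatm s) = conjf P (val s).
Proof. exact: tr_conj. Qed.

Lemma conjm_surj P Q f : f \in F P Q -> exists g : T P Q, conjm g = f.
Proof.
move=> fF; have [g eg] := @tr_pi_surj _ _ _ T P Q (exist _ f fF).
by exists g; rewrite /conjm eg.
Qed.

Lemma hatmM P Q R (s : trcat Ob Q R) (t : trcat Ob P Q) (u : trcat Ob P R) :
  val u = val s * val t -> hatm s \co hatm t = hatm u.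
Proof.
move=> e; apply: etrans (esym (fmapM (tr_delta T) s t)) _.
by congr (fmap _ _); apply: val_inj.
Qed.

Lemma hatm1 P (s : trcat Ob P P) : val s = 1 -> hatm s = idm T P.
Proof.
move=> e; apply: etrans (fmap1 (tr_delta T) P).
by congr (fmap _ _); apply: val_inj.
Qed.

Lemma hatm_inj P Q (s t : trcat Ob P Q) : hatm s = hatm t -> val s = val t.
Proof. by move/tr_delta_inj->. Qed.

Local Notation E P := (aut_ker (tr_pi T) P).

Lemma EkerP P (e : catAut T P) : reflect (conjm (val e) = idf P) (e \in E P).
Proof.
by rewrite inE; apply: (iffP eqP) => [e1|h]; [rewrite /conjm e1 | apply: val_inj].
Qed.

Lemma conjm_orbit P Q (g g' : T P Q) : conjm g = conjm g' ->
  exists2 e : catAut T P, e \in E P & g' = g \co val e.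
Proof. by move=> e; apply/tr_pi_orbit/val_inj. Qed.

Lemma Eker_group_set P : group_set (E P).
Proof.
apply/group_setP; split=> [|a b /EkerP ea /EkerP eb]; apply/EkerP.
  by rewrite val_aut1 conjm_id.
by rewrite val_autM conjmM ea eb -conjm_id -conjmM cmp1m.
Qed.
Canonical Eker_group P := Group (Eker_group_set P).

Lemma Eker_norm P : [set: catAut T P] \subset 'N(E P).
Proof.
apply/subsetP=> a _; rewrite inE; apply/subsetP=> _ /imsetP[b /EkerP eb ->].
apply/EkerP; rewrite conjgE !val_autM !conjmM eb -conjm_id -!conjmM cmp1m.
by have /inversesP[-> _] := aut_inverses a.
Qed.

Lemma cmp_Eker_inj P Q (g : T P Q) (a b : catAut T P) :
    a \in E P -> b \in E P ->
  g \co val a = g \co val b -> a = b.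
Proof.
move=> aE bE e; apply/eqP; rewrite eq_mulgV1; apply/eqP.
apply: (@tr_freer _ _ _ T _ _ g); first by rewrite groupM ?groupV.
rewrite val_autM cmpA e -cmpA.
by have /inversesP[_ ->] := aut_inverses b; rewrite cmpm1.
Qed.

(** An isomorphism of F lifts only to isomorphisms of T: a lift of its inverse is
inverse to g up to elements of E(P) and E(Q), which are invertible. *)
Lemma conjm_onto_inverse P Q (g : T P Q) : conjm g @: P = Q :> {set S} ->
  exists g' : T Q P, inverses g g'.
Proof.
move=> gPQ; have [R _ [eR [gR [h hP [hg gh]]]]] := fhom_image (conjm_fhom g).
have {gPQ eR} eRQ : R = sgr_val Q by apply: group_inj; rewrite eR.
rewrite {R}eRQ in gR hP gh.
have [k ek] := conjm_surj hP.
have [a _ ea] : exists2 a, a \in E P & k \co g = idm T P \co val a.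
  by apply: conjm_orbit; rewrite conjmM ek hg conjm_id.
have [b _ eb] : exists2 b, b \in E Q & g \co k = idm T Q \co val b.
  by apply: conjm_orbit; rewrite conjmM ek gh conjm_id.
have /inversesP[aV _] := aut_inverses a; have /inversesP[_ bV] := aut_inverses b.
exists (val a^-1 \co k); apply: (@split_inverses _ _ _ _ _ _ (k \co val b^-1)).
  by rewrite -cmpA ea cmp1m aV.
by rewrite cmpA eb cmp1m bV.
Qed.

Definition incl P Q (sPQ : P \subset Q) : T P Q := hatm (tr_incl sPQ).

Lemma conjm_incl P Q (sPQ : P \subset Q) : conjm (incl sPQ) = idf P.
Proof. by rewrite conjm_hatm /= conjf1. Qed.

Lemma idfE (P : {group S}) x : x \in P -> idf P x = x.
Proof. by rewrite ffunE => ->. Qed.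

(** Inclusions are injective as maps, so a and b have the same image in F and
differ by an element of E(P), which is trivial by freeness. *)
Lemma incl_mono P Q R (sQR : Q \subset R) (a b : T P Q) :
  incl sQR \co a = incl sQR \co b -> a = b.
Proof.
move=> e; have cab : conjm b = conjm a.
  have := congr1 (@conjm P R) e; rewrite !conjmM conjm_incl.
  by rewrite (fcomp1f (conjm_injs a)) (fcomp1f (conjm_injs b)).
have [k kE ea] := conjm_orbit cab; rewrite ea.
rewrite ea cmpA in e; rewrite (@tr_freer _ _ _ T _ _ _ _ kE e).
by rewrite val_aut1 cmpm1.
Qed.

(** Any lift of the restricted homomorphism agrees with the restriction of g up to
an element of E(P1); absorbing it in the lift makes the square commute. *)
Lemma conjm_restrict P Q P1 Q1 (g : T P Q) (sP : P1 \subset P) (sQ : Q1 \subset Q) :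
    {in P1, forall x, conjm g x \in Q1} ->
  exists g1 : T P1 Q1, incl sQ \co g1 = g \co incl sP.
Proof.
move=> gQ1.
have gF : conjm (g \co incl sP) \in F P1 Q1.
  by apply: fhom_codom (conjm_fhom _) _ => x Px; rewrite conjmM conjm_incl ffunE idfE ?gQ1.
have [k ek] := conjm_surj gF.
have [e _ ee] : exists2 e, e \in aut_ker (tr_pi T) P1 &
    g \co incl sP = (incl sQ \co k) \co val e.
  by apply: conjm_orbit; rewrite [LHS]conjmM conjm_incl ek (fcomp1f (fhom_injs gF)).
by exists (k \co val e); rewrite ee cmpA.
Qed.

Lemma image_ob P (Q : {group S}) f : f \in F P Q ->
  exists2 R : sgr Ob, R \subset Q & R = f @: P :> {set S}.
Proof.
move=> fF; have [R sRQ [eR [fR [h hF [hf fh]]]]] := fhom_image fF.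
have RO : R \in Ob.
  exact: tr_ob_conj (valP P) (fconj_inv fR hF hf fh).
by exists (Sgr RO).
Qed.

Lemma hatP P (R : {set S}) (a : catAut T P) :
  reflect (exists2 s : trcat Ob P P, val s \in R & hatm s = val a)
          (a \in hat (tr_delta T) P R).
Proof.
rewrite inE; apply: (iffP existsP) => [[s /andP[sR /eqP e]]|[s sR e]].
  by exists s.
by exists s; rewrite sR /=; apply/eqP.
Qed.

Lemma hatm_aut P (s : trcat Ob P P) : exists a : catAut T P, val a = hatm s.
Proof.
have nV : (val s)^-1 \in transp P P.
  have sP := valP s; rewrite inE in sP.
  have /eqP e : P :^ (val s)^-1 == P by rewrite eqEcard sP cardJg leqnn.
  by rewrite inE invgK -{1}e conjsgKV.
apply: (@inverses_aut _ _ _ _ (hatm (exist _ (val s)^-1 nV))).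
by apply/inversesP; split; rewrite (@hatmM _ _ _ _ _ (idm (trcat Ob) P)) ?hatm1 //=
   ?mulVg ?mulgV.
Qed.

Lemma hat_group_set P (R : {group S}) : group_set (hat (tr_delta T) P R).
Proof.
apply/group_setP; split=> [|a b /hatP[s sR es] /hatP[t tR et]]; apply/hatP.
  by exists (idm (trcat Ob) P); [exact: group1 | exact: hatm1].
exists (s \co t); first exact: groupM.
by rewrite val_autM -es -et; apply/esym/hatmM.
Qed.
Canonical hat_group P (R : {group S}) := Group (hat_group_set P R).

Lemma hatm_expgn P (s : trcat Ob P P) (a : catAut T P) n :
    hatm s = val a ->
  exists2 t : trcat Ob P P, val t = val s ^+ n & hatm t = val (a ^+ n).
Proof.
move=> es; elim: n => [|n [t et tn]].
  by exists (idm (trcat Ob) P); [by [] | exact: hatm1].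
exists (s \co t); first by rewrite expgS /= et.
by rewrite expgS val_autM -es -tn; apply/esym/hatmM.
Qed.

Lemma hatm_order P (s : trcat Ob P P) (a : catAut T P) :
  hatm s = val a -> #[a] %| #[val s].
Proof.
move=> es; have [t et tn] := hatm_expgn #[val s] es.
rewrite order_dvdn; apply/eqP/val_inj; rewrite /= -tn hatm1 //.
by rewrite et expg_order.
Qed.

Lemma trcat_norm P (s : trcat Ob P P) : val s \in 'N(P).
Proof. by have := valP s; rewrite inE -groupV inE. Qed.

Lemma hatm_equiv P Q (g : T P Q) (x : trcat Ob P P) (y : trcat Ob Q Q) :
  val x \in P -> val y = conjm g (val x) -> hatm y \co g = g \co hatm x.
Proof. exact: tr_equiv. Qed.


(** * Conjugates whose normalizer is Sylow *)

Lemma conjmK P Q (g : T P Q) (g' : T Q P) :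
  inverses g g' -> {in P, cancel (conjm g) (conjm g')}.
Proof.
move=> /inversesP[g'g _] x Px; have := congr1 (@conjm P P) g'g.
by rewrite conjmM conjm_id => /ffunP/(_ x); rewrite ffunE idfE.
Qed.

Lemma conjm_onto P Q (g : T P Q) (g' : T Q P) :
  inverses g g' -> conjm g @: P = Q :> {set S}.
Proof.
move=> gg'; apply/setP=> x; apply/imsetP/idP=> [[y Py ->]|Qx]; first exact: conjm_in.
by exists (conjm g' x); rewrite ?conjm_in // (conjmK (inverses_sym gg')).
Qed.

Lemma card_conjm P Q (g : T P Q) (A : {group S}) : A \subset P -> #|conjm g @: A| = #|A|.
Proof.
move=> /subsetP sAP; apply: card_in_imset; case/inj_homsP: (conjm_injs g) => _ gI _ _.
by move=> x y Ax Ay; apply: gI; apply: sAP.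
Qed.

Lemma hatm_incl P Q (sPQ : P \subset Q) (s : trcat Ob Q Q) (s0 : trcat Ob P P) :
  val s0 = val s -> hatm s \co incl sPQ = incl sPQ \co hatm s0.
Proof.
move=> e; rewrite /incl.
have h : val s \in transp P Q.
  have /transpP sN := valP s0; apply/transpP=> x Px; rewrite -e.
  exact: subsetP sPQ _ (sN x Px).
by rewrite !(@hatmM _ _ _ _ _ (exist _ (val s) h)) //= ?e ?mulg1 ?mul1g.
Qed.

Lemma p_elt_hat P (R : {set S}) (a : catAut T P) : p.-group [set: S] ->
  a \in hat (tr_delta T) P R -> p.-elt a.
Proof.
move=> pS /hatP[s _ /hatm_order sa].
exact: pnat_dvd sa (mem_p_elt pS (in_setT _)).
Qed.

Lemma pgroup_hat P (R : {group S}) :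
  p.-group [set: S] -> p.-group (hat (tr_delta T) P R).
Proof. by move=> pS; apply: p_elt_pgroup => a; apply: p_elt_hat. Qed.

(** The hypothesis is a cancellation property of g that holds both for
isomorphisms and, by freeness, for elements of E(P). *)
Lemma order_cancel P Q (g : T P Q) (b : catAut T Q) (a : catAut T P) :
    (forall n, g \co val (a ^+ n) = g -> a ^+ n = 1) ->
  val b \co g = g \co val a -> #[a] %| #[b].
Proof.
move=> gI ba; rewrite order_dvdn; apply/eqP/gI.
by rewrite -(cmp_expgn _ ba) expg_order val_aut1 cmp1m.
Qed.

(** Axiom (II) extends a to the normalizer of Q, but the extension need not be a
p-element. Its power with exponent the p'-part of its order is one, and the same
power of the p-element a still generates the cyclic group of a. *)
Lemma extend_normalizing Q (a : catAut T Q) (NO : 'N(Q)%G \in Ob)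
    (nQ : sgr Ob := Sgr NO) (sQ : Q \subset nQ) :
    p.-elt a -> a \in 'N(hat (tr_delta T) Q 'N(Q)) ->
    a \notin hat (tr_delta T) Q 'N(Q) ->
  exists a1 b1, [/\ a1 \notin hat (tr_delta T) Q 'N(Q), p.-elt b1 &
    val (b1 : catAut T nQ) \co incl sQ = incl sQ \co val (a1 : catAut T Q)].
Proof.
move=> pa aN na; have nsQ : Q <| nQ by apply: normalG.
have [|gt egt] := @tr_ext _ _ _ T Q Q nQ nQ (val a) (val a^-1) nsQ nsQ (aut_inverses a).
  move=> x xN; have [xh exh] := hatm_aut x.
  have : xh ^ a^-1 \in hat (tr_delta T) Q 'N(Q).
    by rewrite memJ_norm ?groupV //; apply/hatP; exists x.
  case/hatP=> y yN ey; exists y => //.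
  by rewrite -[RHS]/(hatm y) ey conjgE invgK !val_autM exh cmpA.
have {}egt : gt \co incl sQ = incl sQ \co val a.
  move: egt; rewrite /incl /hatm; have -> // : tr_incl (normal_sub nsQ) = tr_incl sQ.
  exact: val_inj.
have [gt' gtV] : exists g', inverses gt g'.
  apply: conjm_onto_inverse; apply/eqP; rewrite eqEcard card_conjm // leqnn andbT.
  by apply/subsetP=> _ /imsetP[x Nx ->]; apply: conjm_in.
have [b eb] := inverses_aut gtV; rewrite -eb in egt.
pose m := (#[b]`_p^')%N; exists (a ^+ m), (b ^+ m); split; last exact: cmp_expgn.
  apply: contra na => aN1.
  have /eqP : generator <[a]> (a ^+ m).
    by rewrite generator_coprime (pnat_coprime pa) // part_pnat.
  by move=> e; rewrite -cycle_subG e cycle_subG.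
rewrite /p_elt; apply: (@pnat_dvd _ (#[b]`_p)%N); last exact: part_pnat.
by rewrite order_dvdn -expgM mulnC partnC // expg_order.
Qed.

(** The conjugate of b by k is a p-element of T(R), so a further automorphism of R
moves it into the given Sylow subgroup. *)
Lemma move_into_hat Q R (k : T Q R) k' (b : catAut T Q) :
    inverses k k' -> p.-elt b ->
    p.-Sylow([set: catAut T R]) (hat (tr_delta T) R 'N(R)) ->
  exists (k1 : T Q R) k1' (s : trcat Ob R R),
    inverses k1 k1' /\ hatm s \co k1 = k1 \co val b.
Proof.
move=> kk' pb sylR; have /inversesP[k'k kk'1] := kk'.
have [c ec] : exists c : catAut T R, val c = k \co (val b \co k').
  apply: (@inverses_aut _ _ _ _ (k \co val b^-1 \co k')).
  exact: inverses_cmp (inverses_cmp (inverses_sym kk') (aut_inverses b)) kk'.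
have cb : val c \co k = k \co val b by rewrite ec -!cmpA k'k cmpm1.
have pc : p.-elt c.
  have bc : val b \co k' = k' \co val c by rewrite ec cmpA k'k cmp1m.
  apply: pnat_dvd (order_cancel _ bc) pb => n e; apply: val_inj.
  by rewrite -[LHS]cmp1m -kk'1 -cmpA e.
have [t _] := Sylow_Jsub sylR (subsetT <[c]>) pc.
rewrite -cycleJ cycle_subG => /hatP[s _ es].
exists (val t^-1 \co k), (k' \co val t), s; split.
  apply: inverses_cmp kk' _.
  exact/inverses_sym/aut_inverses.
have /inversesP[_ tV] := aut_inverses t.
rewrite es conjgE !val_autM -!cmpA (cmpA (val t)) tV cmp1m.
by rewrite cb.
Qed.

(** The element s normalizes Q', since on Q' it restricts to the conjugate of a
by k0. It is not in N': otherwise s = c_k(n) with n in N_S(Q), and axiom (C)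
would identify a with the image of n. As N' is the image of N_S(Q), it
normalizes Q' as well. *)
Lemma normalizer_grows Q Q' (nQ N' : sgr Ob) (sQ : Q \subset nQ) (sQ' : Q' \subset N')
    (k : T nQ N') k' (k0 : T Q Q') k0' (a : catAut T Q) (b : catAut T nQ)
    (s : trcat Ob N' N') :
    nQ = 'N(Q) :> {set S} -> inverses k k' -> inverses k0 k0' ->
    incl sQ' \co k0 = k \co incl sQ -> val b \co incl sQ = incl sQ \co val a ->
    hatm s \co k = k \co val b -> a \notin hat (tr_delta T) Q 'N(Q) ->
  #|'N(Q)| < #|'N(Q')|.
Proof.
move=> eN kk' kk0 ek0 eb sk na.
have /inversesP[k'k _] := kk'; have /inversesP[k0'k0 k0k0'] := kk0.
have ck0 x : x \in Q -> conjm k0 x = conjm k x.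
  move=> Qx; have := congr1 (@conjm _ _) ek0; rewrite !conjmM !conjm_incl.
  by rewrite (fcomp1f (conjm_injs k0)) => ->; rewrite ffunE idfE.
(* The conjugate of a by k0 is the restriction to Q' of the image of s. *)
have eu : incl sQ' \co (k0 \co val a \co k0') = hatm s \co incl sQ'.
  rewrite !cmpA ek0 -(cmpA k) -eb cmpA -sk -(cmpA _ k) -ek0.
  by rewrite -!cmpA k0k0' cmpm1.
have sN : val s \in transp Q' Q'.
  apply/transpP=> x Qx; have := congr1 (@conjm _ _) eu.
  rewrite !conjmM conjm_hatm !conjm_incl.
  move/ffunP/(_ x); rewrite !ffunE Qx (subsetP sQ' _ Qx).
  by rewrite -[RHS]/(_ ^ _) => <-; rewrite !conjm_in.
pose s0 : trcat Ob Q' Q' := exist _ (val s) sN.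
have eu0 : k0 \co val a \co k0' = hatm s0.
  by apply: (@incl_mono _ _ _ sQ'); rewrite eu (@hatm_incl _ _ _ _ s0).
have sN' : N' \subset 'N(Q').
  apply/subsetP=> y0 Ny0.
  have /imsetP[n nN {y0 Ny0}->] : y0 \in conjm k @: nQ by rewrite (conjm_onto kk').
  rewrite inE; apply/subsetP=> _ /imsetP[y Qy ->].
  have /imsetP[x Qx {y Qy}->] : y \in conjm k0 @: Q by rewrite (conjm_onto kk0).
  have nNQ : n \in 'N(Q) by rewrite -eN.
  have Nx := subsetP sQ x Qx.
  have kJ : conjm k (x ^ n) = conjm k x ^ conjm k n.
    have [kM _ _ _] := inj_homsP _ _ _ (conjm_injs k).
    apply: (mulgI (conjm k n)); rewrite -kM ?groupJ // conjgE mulKVg.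
    by rewrite kM // conjgE mulKVg.
  rewrite ck0 // -kJ -ck0 ?memJ_norm //.
  by rewrite conjm_in // memJ_norm.
have nsN' : val s \notin N'.
  apply: contra na => N's.
  have /imsetP[n nN es] : val s \in conjm k @: nQ by rewrite (conjm_onto kk').
  have nNQ : n \in 'N(Q) by rewrite -eN.
  pose x : trcat Ob nQ nQ := exist _ n (norm_transp (subsetP (normG nQ) n nN)).
  pose x0 : trcat Ob Q Q := exist _ n (norm_transp nNQ).
  apply/hatP; exists x0 => //; apply: (@incl_mono _ _ _ sQ).
  rewrite -eb -(@hatm_incl _ _ _ x) //; congr (_ \co _).
  by rewrite -[LHS]cmp1m -k'k -cmpA -(hatm_equiv (y := s)) // sk cmpA k'k cmp1m.
rewrite -eN -(card_conjm k (subxx nQ)) (conjm_onto kk').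
apply/proper_card/properP; split=> //; exists (val s) => //.
exact: (trcat_norm s0).
Qed.

Lemma max_normalizer P : exists Q (h : T P Q) h', inverses h h' /\
  forall R, isomorphic T P R -> #|'N(R)| <= #|'N(Q)|.
Proof.
have isoPP : isomorphic T P P by apply/existsP; exists (idm T P); apply: idm_iso.
have [Q /existsP[h /existsP[h' hh']] maxQ] :=
  @arg_maxnP ({P : {group S} | P \in Ob} : finType) P (isomorphic T P)
    (fun Q => #|'N(sgr_val Q)|) isoPP.
by exists Q, h, h'.
Qed.

(** If the image of N_S(Q) is not Sylow for a Q with normalizer of maximal order,
it is normalized by a p-element outside of it, because normalizers grow in
p-groups; by the induction hypothesis for the strictly larger group N_S(Q), the
previous lemmas then contradict the maximality. *)
Theorem Sylow_conjugate P : p.-group [set: S] ->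
  exists Q (h : T P Q) h', inverses h h' /\
    p.-Sylow([set: catAut T Q]) (hat (tr_delta T) Q 'N(Q)).
Proof.
move=> pS; have [m] := ubnP (#|S| - #|P|); elim: m P => // m IH P ltm.
have [Q [h [h' [hh' maxQ]]]] := max_normalizer P.
exists Q, h, h'; split=> //.
(* For Q = S this is axiom (I); otherwise N_S(Q) is strictly larger than Q. *)
have [eQ|neQ] := eqVneq (sgr_val Q) [set: S]%G.
  have -> : Q = Sgr (tr_obS T) by apply: val_inj.
  have -> : 'N(sgr_val (Sgr (tr_obS T))) = setT.
    by apply/eqP; rewrite eqEsubset subsetT; apply: (normG [set: S]%G).
  exact: tr_Sylow.
have [R sylR sNR] := Sylow_superset (subsetT _) (pgroup_hat Q 'N(Q) pS).
have [eNR|neNR] := eqVneq (hat (tr_delta T) Q 'N(Q)) R; first by rewrite eNR.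
have pR := pHall_pgroup sylR.
have ltNR : hat (tr_delta T) Q 'N(Q) \proper R by rewrite properEneq neNR.
have /properP[_ [a /setIP[Ra aN] na]] := nilpotent_proper_norm (pgroup_nil pR) ltNR.
have NO : 'N(Q)%G \in Ob := tr_ob_over (valP Q) (normG Q).
pose nQ : sgr Ob := Sgr NO; have sQ : Q \subset nQ := normG Q.
have [a1 [b1 [na1 pb1 eb1]]] := extend_normalizing sQ (mem_p_elt pR Ra) aN na.
have ltQ : #|Q| < #|nQ|.
  apply: proper_card.
  have := nilpotent_proper_norm (pgroup_nil pS) (_ : Q \proper setT).
  rewrite setTI; apply; rewrite properEneq subsetT andbT.
  by apply: contra neQ => /eqP e; apply/eqP/group_inj.
have cPQ : #|P| = #|Q| by rewrite -(card_conjm h (subxx P)) (conjm_onto hh').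
have [|N' [k [k' [kk' sylN']]]] := IH nQ.
  rewrite -ltnS; apply: leq_trans ltm; rewrite ltnS cPQ.
  exact: (ltn_sub2l (leq_trans ltQ (max_card _)) ltQ).
have [k1 [k1' [s [kk1 sk1]]]] := move_into_hat kk' pb1 sylN'.
have [Q' sQ' eQ'] := image_ob (conjm_fhom (k1 \co incl sQ)).
have k1Q' : {in Q, forall x, conjm k1 x \in Q'}.
  move=> x Qx; have : conjm k1 x \in (Q' : {set S}); last by [].
  by rewrite eQ'; apply/imsetP; exists x; rewrite // conjmM conjm_incl ffunE idfE.
have [k0 ek0] := conjm_restrict sQ sQ' k1Q'.
have [k0' kk0] : exists k0', inverses k0 k0'.
  apply: conjm_onto_inverse; rewrite eQ' -ek0 conjmM conjm_incl.
  by rewrite (fcomp1f (conjm_injs k0)).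
have eN : nQ = 'N(Q) :> {set S} by [].
have := normalizer_grows eN kk1 kk0 ek0 eb1 sk1 na1.
rewrite ltnNge; case/negP; apply: maxQ.
apply/existsP; exists (k0 \co h); apply/existsP; exists (h' \co k0').
exact: inverses_cmp.
Qed.

(** * The group E(P) :&: K(P) and its Sylow p-subgroup *)

Section Theta.
Variables (X : finType) (theta : sym_rep T X).
Local Notation l := (theta_action theta).

Lemma srep_id P : srep theta (idm T P) = 1.
Proof.
by apply: (mulgI (srep theta (idm T P))); rewrite -srepM cmp1m mulg1.
Qed.

Lemma srep_hatm P Q (s : trcat Ob P Q) : srep theta (hatm s) = l (val s).
Proof. exact: srep_delta. Qed.

Lemma srep_incl1 P Q (sPQ : P \subset Q) : srep theta (incl sPQ) = 1.
Proof. exact: srep_incl. Qed.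

Definition EcapK P : {set catAut T P} := Eker P :&: Kker theta P.

Lemma EcapKP P (a : catAut T P) :
  reflect (conjm (val a) = idf P /\ srep theta (val a) = 1) (a \in EcapK P).
Proof.
rewrite inE [X in _ && X]inE; apply: (iffP andP) => [[/EkerP ? /eqP ?] //|[? ?]].
by split; [apply/EkerP | apply/eqP].
Qed.

Lemma EcapK_Eker P (a : catAut T P) : a \in EcapK P -> a \in E P.
Proof. by case/setIP. Qed.

Lemma EcapK_group_set P : group_set (EcapK P).
Proof.
apply/group_setP; split=> [|a b aEK bEK].
  by apply/EcapKP; rewrite val_aut1 conjm_id srep_id.
apply/EcapKP; split; first by apply/EkerP; rewrite groupM ?EcapK_Eker.
have /EcapKP[_ sa] := aEK; have /EcapKP[_ sb] := bEK.
by rewrite val_autM srepM sa sb mulg1.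
Qed.
Canonical EcapK_group P := Group (EcapK_group_set P).

Lemma EcapK_norm P : [set: catAut T P] \subset 'N(EcapK P).
Proof.
apply/subsetP=> a _; rewrite inE; apply/subsetP=> _ /imsetP[b bEK ->].
have /EcapKP[_ sb] := bEK; apply/EcapKP; split.
  apply/EkerP; rewrite memJ_norm ?EcapK_Eker //.
  by apply: (subsetP (Eker_norm P)); rewrite inE.
rewrite conjgE !val_autM !srepM sb mulg1 -srepM.
by have /inversesP[-> _] := aut_inverses a; rewrite srep_id.
Qed.

(** Both b g and g have the same image in F and under theta, so they differ on the
right by an element of E(P) on which theta is trivial. *)
Lemma EcapK_push P Q (g : T P Q) (b : catAut T Q) : b \in EcapK Q ->
  exists2 a, a \in EcapK P & val b \co g = g \co val a.
Proof.
case/EcapKP=> cb sb; have [a aE ea] : exists2 a, a \in E P &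
    val b \co g = g \co val a.
  by apply: conjm_orbit; rewrite conjmM cb (fcomp1f (conjm_injs g)).
exists a => //; apply/EcapKP; split; first exact/EkerP.
have := congr1 (@srep _ _ _ _ _ theta P Q) ea; rewrite !srepM sb mulg1.
by move/(congr1 (fun z => z * (srep theta g)^-1)); rewrite mulgV mulgK.
Qed.

Lemma EcapK_push_order P Q (g : T P Q) (a : catAut T P) (b : catAut T Q) :
  a \in EcapK P -> val b \co g = g \co val a -> #[a] %| #[b].
Proof.
move=> aEK; apply: order_cancel => n; apply: tr_freer.
exact: groupX (EcapK_Eker aEK).
Qed.

Lemma hatm_EcapK P (s : trcat Ob P P) (a : catAut T P) :
  hatm s = val a -> (a \in EcapK P) = (val s \in ZSX l P).
Proof.
move=> es; apply/EcapKP/setIP; rewrite -es conjm_hatm srep_hatm => -[h1 h2]; split.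
- apply/centP=> x Px; apply/commute_sym/commgP/conjg_fixP.
  have /ffunP/(_ x) := h1; rewrite !ffunE Px => e.
  by rewrite -{1}e conjgKV.
- by rewrite inE h2.
- apply/ffunP=> x; rewrite !ffunE; case: ifP => // Px.
  by apply/conjg_fixP/commgP/commute_sym; apply: (centP _ x Px); rewrite groupV.
- by move: h2; rewrite inE => /eqP.
Qed.

Lemma ZX_group_set P : group_set (ZX l P).
Proof.
apply/group_setP; split=> [|x y]; first by rewrite inE group1 inE lact1 eqxx.
move=> /setIP[Zx Kx] /setIP[Zy Ky]; apply/setIP; split; first exact: groupM.
by move: Kx Ky; rewrite !inE lactM => /eqP-> /eqP->; rewrite mulg1.
Qed.
Canonical ZX_group P := Group (ZX_group_set P).
Local Notation hatZ P := (hat (tr_delta T) P (ZX l (sgr_val P))).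

Lemma hatZ_sub P : hatZ P \subset EcapK P.
Proof.
apply/subsetP=> a /hatP[s /setIP[/setIP[_ Cs] Ks] es].
by rewrite (hatm_EcapK es) inE Cs.
Qed.

Lemma hatZ_cent P : hatZ P \subset 'C(EcapK P).
Proof.
apply/subsetP=> a /hatP[s /setIP[/setIP[Ps _] _] es]; apply/centP=> b bEK.
apply: val_inj; rewrite [LHS]val_autM [RHS]val_autM -es.
by apply: hatm_equiv => //; have /EcapKP[-> _] := bEK; rewrite idfE.
Qed.

Hypothesis pS : p.-group [set: S].

(** Every p-element a is in the image of Z(P;X): pushed to Q it becomes conjugate
to the image of an element of Z_S(Q;X) = Z(Q;X), which lies in Q, and so by
axiom (C) comes from an element of P. *)
Lemma hatZ_Sylow P :
    (forall Q, isomorphic T P Q -> ZX l Q = ZSX l Q) ->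
  p.-Sylow(EcapK P) (hatZ P).
Proof.
move=> cP; have isoPP : isomorphic T P P.
  by apply/existsP; exists (idm T P); apply: idm_iso.
suff p_hatZ a : a \in EcapK P -> p.-elt a -> a \in hatZ P.
  have [R sylR sZR] := Sylow_superset (hatZ_sub P) (pgroup_hat P (ZX_group P) pS).
  have /eqP <- // : R :==: hatZ P.
  rewrite eqEsubset sZR andbT; apply/subsetP=> a Ra; apply: p_hatZ.
    exact: (subsetP (pHall_sub sylR)).
  exact: mem_p_elt (pHall_pgroup sylR) Ra.
move=> aEK pa; have [Q [h [h' [hh' sylQ]]]] := Sylow_conjugate P pS.
have isoPQ : isomorphic T P Q.
  by apply/existsP; exists h; apply/existsP; exists h'.
have [b bEK ab] := EcapK_push h' aEK.
have pb : p.-elt b := pnat_dvd (EcapK_push_order bEK ab) pa.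
have [t _] := Sylow_Jsub sylQ (subsetT <[b]>) pb.
rewrite -cycleJ cycle_subG => /hatP[s _ es].
have : b ^ t \in EcapK Q by rewrite memJ_norm // (subsetP (EcapK_norm Q)) ?in_setT.
rewrite (hatm_EcapK es) -cP // => /setIP[/setIP[Qs _] _].
have [f [k [/inversesP[_ fk] af]]] : exists (f : T Q P) (k : T P Q),
    inverses f k /\ val a \co f = f \co hatm s.
  have /inversesP[_ tV] := aut_inverses t.
  exists (h' \co val t), (val t^-1 \co h); split.
    exact: inverses_cmp (aut_inverses t) (inverses_sym hh').
  rewrite es conjgE !val_autM cmpA ab -!cmpA; congr (_ \co _).
  by rewrite !cmpA tV cmp1m.
pose y := conjm f (val s); have Py : y \in P by apply: conjm_in.
pose sy : trcat Ob P P := exist _ y (norm_transp (subsetP (normG P) y Py)).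
have esy : hatm sy = val a.
  have := hatm_equiv (y := sy) Qs (erefl _); rewrite -af.
  by move/(congr1 (fun m => m \co k)); rewrite -!cmpA !fk !cmpm1.
apply/hatP; exists sy => //.
by rewrite cP // -(hatm_EcapK esy).
Qed.


(** * Morphisms of the generated fusion action system *)

(** Lifts to T the factorization of a morphism of F as an isomorphism followed by
an inclusion, keeping the value of theta, which is trivial on inclusions. *)
Lemma conjm_factor P (R : {group S}) Q (g : T P Q) h :
    conjm g \in F P R -> h \in F R P ->
    fcomp h (conjm g) = idf P -> fcomp (conjm g) h = idf R ->
  exists (R' : sgr Ob) (k : T P R') (k' : T R' P),
    [/\ R = R', inverses k k', conjm k = conjm g, conjm k' = h & srep theta k = srep theta g].
Proof.
move=> gR hP hg gh.
pose R' : sgr Ob := Sgr (tr_ob_conj (valP P) (fconj_inv gR hP hg gh)).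
have sRQ : R' \subset Q.
  apply/subsetP=> x Rx; have /ffunP/(_ x) := gh; rewrite !ffunE Rx => <-.
  exact/conjm_in/(inj_homs_in (fhom_injs hP)).
have [k0 ek0] := @conjm_surj P R' _ gR.
have [a _ ea] : exists2 a, a \in E P &
    g = incl sRQ \co k0 \co val a.
  by apply: conjm_orbit; rewrite conjmM conjm_incl ek0 (fcomp1f (fhom_injs gR)).
pose k := k0 \co val a.
have egk : g = incl sRQ \co k by rewrite /k cmpA.
have ck : conjm k = conjm g by rewrite egk conjmM conjm_incl (fcomp1f (conjm_injs k)).
have [k' kk'] : exists k', inverses k k'.
  apply: conjm_onto_inverse; rewrite ck; apply/setP=> x; apply/imsetP/idP.
    by case=> y Py ->; rewrite -ck conjm_in.
  move=> Rx; exists (h x); last by have /ffunP/(_ x) := gh; rewrite !ffunE Rx.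
  exact: inj_homs_in (fhom_injs hP) Rx.
exists R', k, k'; split=> //; last by rewrite egk srepM srep_incl1 mulg1.
have /inversesP[_ /(congr1 (@conjm _ _))] := kk'; rewrite conjmM conjm_id ck => e.
have k'I := conjm_injs k'.
by rewrite -(fcomp1f k'I) -hg -fcompA e (fcompf1 (fhom_injs hP)).
Qed.

(** The condition of coming from T is imposed only when P is an object of T. As
the objects are closed under F-conjugacy and overgroups, requiring f.1 to be in
F makes the target an object too, and the two cases do not mix under composition
or inversion. *)
Definition lifted_hom (P Q : {group S}) : {set fpair S X} :=
  [set f in intertwined l P Q |
     (f.1 \in F P Q) && `[< P \in Ob -> theta_gen theta P Q f >]].

Lemma lifted_homP (P Q : {group S}) f :
  reflect [/\ f \in intertwined l P Q, f.1 \in F P Q &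
             P \in Ob -> theta_gen theta P Q f] (f \in lifted_hom P Q).
Proof.
rewrite [X in reflect _ X]in_set.
by apply: (iffP and3P) => -[fI fF /asboolP fT]; split=> //; apply/asboolP.
Qed.

Lemma sgr_inj (P Q : sgr Ob) : P = Q :> {group S} -> P = Q.
Proof. exact: val_inj. Qed.

Lemma lifted_cmp (P Q R : {group S}) g f :
  g \in lifted_hom Q R -> f \in lifted_hom P Q -> pcomp g f \in lifted_hom P R.
Proof.
case/lifted_homP=> gI gF gT /lifted_homP[fI fF fT]; apply/lifted_homP; split.
- exact: intertwined_cmp gI fI.
- exact: fhom_cmp gF fF.
case/fT=> P' [Q' [f0 [eP eQ ef]]].
have [|Q2 [R' [g0 [eQ2 eR eg]]]] := gT; first by rewrite eQ (valP Q').
have eQQ : Q2 = Q' by apply: sgr_inj; rewrite -eQ2 eQ.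
subst Q2; exists P', R', (g0 \co f0); split=> //.
by rewrite ef eg srepM; congr (_, _); apply: esym (conjmM g0 f0).
Qed.

Lemma lifted_conj (P Q : {group S}) s :
  s \in transp P Q -> (conjf P s, l s) \in lifted_hom P Q.
Proof.
move=> sP; apply/lifted_homP; split; [exact: intertwined_conj | exact: fhom_conj |].
move=> PO; have [Q' /subsetP sQ' eQ'] := @image_ob (Sgr PO) Q _ (fhom_conj F sP).
have QO : Q \in Ob by apply: tr_ob_over (valP Q') _; apply/subsetP.
pose s' : trcat Ob (Sgr PO) (Sgr QO) := exist _ s sP.
exists (Sgr PO), (Sgr QO), (hatm s'); split=> //.
by rewrite srep_hatm; congr (_, _); apply: esym (conjm_hatm s').
Qed.

Lemma lifted_div (P Q : {group S}) f : f \in lifted_hom P Q ->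
  exists2 R : {group S}, R \subset Q & exists g h,
    [/\ g \in lifted_hom P R, h \in lifted_hom R P,
        pcomp h g = pid X P, pcomp g h = pid X R & f = pcomp (pid X R) g].
Proof.
case: f => f sg /lifted_homP[/= /intwP[/= _ fl] fF fT].
have [R sRQ [eR [fR [h hF [hf fh]]]]] := fhom_image fF.
have fI := fhom_injs fR; have hI := fhom_injs hF.
exists R => //; exists (f, sg), (h, sg^-1); split; last first.
- by rewrite /pcomp /= mulg1 (fcomp1f fI).
- by rewrite /pcomp /= fh mulVg.
- by rewrite /pcomp /= hf mulgV.
- apply/lifted_homP; split=> //.
    apply/intwP; split=> //= x Rx.
    have hP := inj_homs_in hI Rx.
    have <- : f (h x) = x by have /ffunP/(_ x) := fh; rewrite !ffunE Rx.
    by rewrite -fl // conjgK; have /ffunP/(_ (h x)) := hf; rewrite !ffunE hP => ->.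
  move=> RO; have PO : P \in Ob := tr_ob_conj RO (fconj_inv hF fR fh hf).
  have [P' [Q' [g [eP eQ [ef es]]]]] := fT PO; subst P Q f sg.
  have [R' [k [k' [eRR kk' _ ek' sk]]]] := conjm_factor fR hF hf fh.
  exists R', P', k'; split=> //; congr (_, _); rewrite -?sk; first exact: esym ek'.
  apply: (mulgI (srep theta k)); rewrite -srepM.
  by have /inversesP[_ _] := kk'; rewrite mulgV (proj1 (inversesP _ _ _)) ?srep_id.
- apply/lifted_homP; split=> //; first exact/intwP.
  case/fT=> P' [Q' [g [eP eQ [ef es]]]]; subst P Q f sg.
  have [R' [k [k' [eRR _ ek _ sk]]]] := conjm_factor fR hF hf fh.
  by exists P', R', k; split=> //; congr (_, _); [apply: esym ek | apply: esym sk].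
Qed.

Definition lifted_system : fusion_action_system l.
Proof.
exists lifted_hom; [| exact: lifted_cmp | exact: lifted_conj | exact: lifted_div].
by move=> P Q; apply/subsetP=> f /lifted_homP[].
Defined.

Lemma Xtheta_conjm P Q (g : T P Q) : (conjm g, srep theta g) \in Xtheta theta P Q.
Proof.
have gen : theta_gen theta P Q (conjm g, srep theta g) by exists P, Q, g.
apply/gen_homP; split; first exact: theta_gen_intertwined gen.
by move=> Y; apply.
Qed.

(** The generated system is contained in [lifted_system]. *)
Lemma Xtheta_lift P Q f : f \in Xtheta theta P Q ->
  exists g : T P Q, f = (conjm g, srep theta g).
Proof.
case/gen_homP=> _ fY; have : f \in lifted_hom P Q.
  apply: (fY lifted_system) => P0 Q0 f0 f0T.
  apply/lifted_homP; split=> //; first exact: theta_gen_intertwined.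
  by case: f0T => P' [Q' [g [-> -> ->]]]; apply: conjm_fhom.
case/lifted_homP=> _ _ /(_ (valP P))[P' [Q' [g [eP eQ ->]]]].
have eP' := sgr_inj eP; have eQ' := sgr_inj eQ; subst P' Q'.
by exists g.
Qed.

Lemma Xcentric_iso P Q : sgr_val P \in Xcentric (Xtheta theta) ->
  isomorphic T P Q -> ZX l Q = ZSX l Q.
Proof.
rewrite inE => /forallP/(_ (sgr_val Q))/implyP cP /existsP[g /existsP[g' gg']].
have mF P' Q' (h : T P' Q') : conjm h \in underlying (Xtheta theta) P' Q'.
  by apply/imsetP; exists (conjm h, srep theta h); rewrite ?Xtheta_conjm.
apply/eqP/cP; have /inversesP[g'g gg'1] := gg'.
by apply: (fconj_inv (mF _ _ g) (mF _ _ g')); rewrite -conjmM ?g'g ?gg'1 conjm_id.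
Qed.

End Theta.

End Transporter.

(** * Quotients of categories by groups of automorphisms *)

Section QuotientCategory.
Variables (O O' : Type) (C : category O) (i : O' -> O).
Variable A : forall P : O', {group catAut C (i P)}.
Local Notation qhom P Q := (quot_hom (i Q) (A P)).

Lemma quot_classP P Q (g g' : C (i P) (i Q)) :
  quot_class (A P) g = quot_class (A P) g' <->
  exists2 a, a \in A P & g' = g \co val a.
Proof.
split=> [e|[a Aa ->]].
  have : g' \in rorbit (A P) g.
    have -> : rorbit (A P) g = rorbit (A P) g' := congr1 val e.
    apply/imsetP; exists 1; first exact: group1.
    by rewrite val_aut1 cmpm1.
  by case/imsetP=> a Aa ->; exists a.
apply: val_inj; apply/setP=> h; apply/imsetP/imsetP=> -[b Ab ->].
  exists (a^-1 * b); first by rewrite groupM ?groupV.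
  rewrite val_autM cmpA -(cmpA g).
  by have /inversesP[_ ->] := aut_inverses a; rewrite cmpm1.
by exists (a * b); rewrite ?groupM // val_autM cmpA.
Qed.

Lemma quot_ex P Q (B : qhom P Q) : exists g, rorbit (A P) g == val B.
Proof. by case/imsetP: (valP B) => g _ e; exists g; rewrite -[val B]/(sval B) e. Qed.

(** Functions on orbits are defined through a chosen representative; the lemmas
below show that their values do not depend on it. *)
Definition quot_repr P Q (B : qhom P Q) : C (i P) (i Q) := xchoose (quot_ex B).

Lemma quot_reprK P Q (B : qhom P Q) : quot_class (A P) (quot_repr B) = B.
Proof. by apply: val_inj; apply/eqP; apply: (xchooseP (quot_ex B)). Qed.

Lemma quot_class_repr P Q (g : C (i P) (i Q)) :
  exists2 a, a \in A P & quot_repr (quot_class (A P) g) = g \co val a.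
Proof. by apply/quot_classP; rewrite quot_reprK. Qed.

Hypothesis A_push : forall P Q (g : C (i P) (i Q)) b, b \in A Q ->
  exists2 a, a \in A P & val b \co g = g \co val a.

Definition quot_cmp P Q R (h : qhom Q R) (g : qhom P Q) : qhom P R :=
  quot_class (A P) (quot_repr h \co quot_repr g).

Lemma quot_cmpE P Q R (h : C (i Q) (i R)) (g : C (i P) (i Q)) :
  quot_cmp (quot_class (A Q) h) (quot_class (A P) g) = quot_class (A P) (h \co g).
Proof.
apply/esym/quot_classP.
have [b Ab ->] := quot_class_repr h; have [a Aa ->] := quot_class_repr g.
have [c Ac bg] := A_push g Ab.
exists (c * a); first exact: groupM.
by rewrite val_autM !cmpA -(cmpA h g) -bg !cmpA.
Qed.

Definition quot_cat_class : cat_class (fun P Q : O' => qhom P Q).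
Proof.
exists (fun P => quot_class (A P) (idm C (i P))) quot_cmp.
- by move=> P Q f; rewrite -(quot_reprK f) quot_cmpE cmp1m.
- by move=> P Q f; rewrite -(quot_reprK f) quot_cmpE cmpm1.
- move=> P Q R U h g f.
  by rewrite -(quot_reprK f) -(quot_reprK g) -(quot_reprK h) !quot_cmpE cmpA.
Defined.

Definition quot_cat : category O' := Cat quot_cat_class.

Definition quot_functor : functor (full_sub i C) quot_cat id.
Proof.
exists (fun P Q (g : full_sub i C P Q) => quot_class (A P) g) => // P Q R g f.
exact/esym/quot_cmpE.
Defined.

End QuotientCategory.

(** * The X-centric linking action system *)

Section LinkingActionSystem.
Variables (p : nat) (S : finGroupType) (pS : p.-group [set: S]).
Variables (F : fusion_system S) (T : transporter_system p F).
Variables (X : finType) (theta : sym_rep T X).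
Hypothesis cX_ob : Xcentric (Xtheta theta) \subset tr_ob T.
Local Notation l := (theta_action theta).
Local Notation XX := (Xtheta theta).
Local Notation cX := (Xcentric XX).
Local Notation inT := (sgr_sub cX_ob).
Implicit Types P Q R : sgr cX.

Definition EK' P : {group catAut T (inT P)} := 'O_p^'(EcapK_group theta (inT P))%G.

Lemma hatZ_Sylow_Xcentric P :
  p.-Sylow(EcapK theta (inT P)) (hat (tr_delta T) (inT P) (ZX l P)).
Proof.
apply: (hatZ_Sylow pS) => Q.
exact: (@Xcentric_iso _ _ _ _ _ _ (inT P) Q (valP P)).
Qed.

Lemma EcapK_dprod P :
  hat (tr_delta T) (inT P) (ZX l P) \x EK' P = EcapK theta (inT P).
Proof.
exact: (central_Sylow_dprod (Z := hat_group _ (ZX_group theta (inT P)))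
          (hatZ_Sylow_Xcentric P) (hatZ_cent _ _)).
Qed.

Lemma EcapK_dprod_eq P (A : {group catAut T (inT P)}) : p^'.-group A ->
    hat (tr_delta T) (inT P) (ZX l P) \x A = EcapK theta (inT P) ->
  A = [set a in EcapK theta (inT P) | p^'.-elt a] :> {set _}.
Proof.
move=> p'A; apply: (@dprod_p'_eltE _ p _ (hat_group _ (ZX_group theta (inT P)))) => //.
exact: pgroup_hat.
Qed.

Lemma EK'E P : EK' P = [set a in EcapK theta (inT P) | p^'.-elt a] :> {set _}.
Proof. exact: EcapK_dprod_eq (pcore_pgroup _ _) (EcapK_dprod P). Qed.

Lemma EK'P P (a : catAut T (inT P)) :
  reflect (a \in EcapK theta (inT P) /\ p^'.-elt a) (a \in EK' P).
Proof.
rewrite -[a \in EK' P]/(a \in (EK' P : {set _})) EK'E [X in reflect _ X]in_set.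
exact: andP.
Qed.

Lemma EK'_push P Q (g : T (inT P) (inT Q)) b : b \in EK' Q ->
  exists2 a, a \in EK' P & val b \co g = g \co val a.
Proof.
case/EK'P=> bEK p'b; have [a aEK ba] := EcapK_push g bEK.
exists a => //; apply/EK'P; split=> //.
exact: pnat_dvd (EcapK_push_order aEK ba) p'b.
Qed.

(** The image of s is a p-element, and a p'-element as a member of EK'(P). *)
Lemma EK'_hat1 P (s : trcat (tr_ob T) (inT P) (inT P)) a :
  a \in EK' P -> hatm s = val a -> val s = 1.
Proof.
case/EK'P=> _ p'a es.
have pa : p.-elt a by apply: (@p_elt_hat _ _ _ _ _ setT) => //; apply/hatP; exists s.
have a1 : a = 1.
  by apply/eqP; rewrite -order_eq1; apply/eqP; apply: pnat_1 pa p'a.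
have e1 : hatm (idm (trcat _) (inT P)) = val a by rewrite a1; apply: hatm1.
by apply: (@hatm_inj _ _ _ _ _ _ s (idm (trcat _) (inT P))); rewrite es e1.
Qed.

Definition linking_cat : category (sgr cX) := quot_cat EK'_push.

Definition linking_delta : functor (trcat cX) linking_cat id.
Proof.
exists (fun P Q (s : trcat cX P Q) =>
  quot_class (EK' P) (@hatm _ _ _ T (inT P) (inT Q) s)) => [P|P Q R s t].
  by congr (quot_class _ _); apply: hatm1.
apply: etrans (esym (quot_cmpE EK'_push _ _)).
by congr (quot_class _ _); apply/esym/hatmM.
Defined.

Definition theta_pair P Q (B : linking_cat P Q) : xcat XX P Q :=
  exist _ (conjm (quot_repr B), srep theta (quot_repr B))
    (@Xtheta_conjm _ _ _ _ _ theta (inT P) (inT Q) (quot_repr B)).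

Lemma EK'_trivial P Q (g : T (inT P) (inT Q)) a : a \in EK' P ->
  conjm (g \co val a) = conjm g /\ srep theta (g \co val a) = srep theta g.
Proof.
case/EK'P=> /EcapKP[ca sa] _.
by rewrite conjmM srepM ca sa mul1g (fcompf1 (conjm_injs g)).
Qed.

Lemma theta_pairE P Q (g : T (inT P) (inT Q)) :
  val (theta_pair (quot_class (EK' P) g : linking_cat P Q)) =
    (conjm g, srep theta g).
Proof.
rewrite /=; have [a aEK ->] := quot_class_repr EK' g.
by have [-> ->] := EK'_trivial g aEK.
Qed.

Definition linking_pi :
  functor linking_cat (full_sub (@sgr_val S cX) (xcat XX)) id.
Proof.
refine (@Functor _ _ linking_cat (full_sub (@sgr_val S cX) (xcat XX)) id
  theta_pair _ _) => [P|P Q R g f]; apply: val_inj.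
  by rewrite [LHS]theta_pairE conjm_id srep_id.
apply: etrans (theta_pairE (quot_repr g \co quot_repr f)) _.
by rewrite conjmM srepM.
Defined.

Lemma linking_cmpE P Q R (h : T (inT Q) (inT R)) (g : T (inT P) (inT Q)) :
  (quot_class (EK' Q) h : linking_cat Q R) \co (quot_class (EK' P) g : linking_cat P Q)
    = quot_class (EK' P) (h \co g).
Proof. exact: (quot_cmpE EK'_push h g). Qed.

Lemma linking_deltaE P Q (s : trcat cX P Q) :
  fmap linking_delta s = quot_class (EK' P) (@hatm _ _ _ T (inT P) (inT Q) s).
Proof. by []. Qed.

Lemma linking_piE P Q (g : T (inT P) (inT Q)) :
  val (fmap linking_pi (P := P) (Q := Q) (quot_class (EK' P) g)) =
    (conjm g, srep theta g).
Proof. exact: theta_pairE. Qed.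

(** Reduces statements about the quotient to morphisms of T, on which composition
and the structure functors are explicit. *)
Lemma linking_ind P Q (K : linking_cat P Q -> Prop) :
  (forall g : T (inT P) (inT Q), K (quot_class (EK' P) g)) -> forall B, K B.
Proof. by move=> KE B; rewrite -(quot_reprK B). Qed.

(** If the images of s and t differ by an element of EK'(P), then c_s = c_t on P, so
this element is the image of the element s^-1 t of C_S(P), and is trivial. *)
Lemma linking_delta_inj P Q (s t : trcat (tr_ob T) (inT P) (inT Q)) :
  quot_class (EK' P) (hatm s) = quot_class (EK' P) (hatm t) -> val s = val t.
Proof.
case/quot_classP=> a aEK' ea.
have sa : conjm (hatm t) = conjm (hatm s).
  by rewrite ea; have [-> _] := EK'_trivial (hatm s) aEK'.
have ux x : x \in P -> x ^ ((val s)^-1 * val t)^-1 = x.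
  move=> Px; rewrite invMg invgK conjgM.
  have /ffunP/(_ x) := sa; rewrite !conjm_hatm !ffunE.
  by rewrite -[x \in sgr_val _]/(x \in P) Px => ->; rewrite conjgKV.
have uN : (val s)^-1 * val t \in transp (inT P) (inT P).
  by apply/transpP=> x Px; rewrite ux.
pose u : trcat (tr_ob T) (inT P) (inT P) :=
  exist (fun z => z \in transp (inT P) (inT P)) _ uN.
have [b eb] := hatm_aut u; have ab : b = a.
  apply: (@cmp_Eker_inj _ _ _ _ _ _ (hatm s)); last first.
  - by rewrite -ea eb; apply: hatmM; rewrite /= mulKVg.
  - by case/EK'P: aEK' => /EcapK_Eker.
  - apply/EkerP; rewrite eb conjm_hatm; apply/ffunP=> x; rewrite !ffunE.
    by case: ifP => // Px; rewrite ux.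
have /eqP := EK'_hat1 aEK' (esym (etrans (congr1 val (esym ab)) eb)).
by rewrite /= -eq_mulVg1 => /eqP.
Qed.

(** The morphisms g and g' differ by an element of E(P) :&: K(P); its component in
EK'(P) is invisible in the quotient. *)
Lemma linking_orbit P Q (g g' : T (inT P) (inT Q)) :
    conjm g = conjm g' -> srep theta g = srep theta g' ->
  exists2 z : trcat (tr_ob T) (inT P) (inT P), val z \in ZX l P &
    quot_class (EK' P) g' = quot_class (EK' P) (g \co hatm z).
Proof.
move=> ec es; have [e eE eg] := conjm_orbit ec.
have : e \in EcapK theta (inT P).
  apply/EcapKP; split; first exact/EkerP.
  by apply: (mulIg (srep theta g)); rewrite mul1g -srepM -eg.
rewrite -(dprodW (EcapK_dprod P)) => /mulsgP[zh a /hatP[z zZ ez] aEK' e_za].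
exists z => //; apply/esym/quot_classP; exists a => //.
by rewrite eg e_za val_autM -ez cmpA.
Qed.

Lemma ZX_EcapK P (z : trcat (tr_ob T) (inT P) (inT P)) : val z \in ZX l P ->
  exists2 b, b \in EcapK theta (inT P) & val b = hatm z.
Proof.
case/setIP=> /setIP[_ Cz] Kz; have [b eb] := hatm_aut z; exists b => //.
by rewrite (hatm_EcapK _ (esym eb)); apply/setIP.
Qed.

Lemma linking_systemP : linking_action_system linking_delta linking_pi.
Proof.
split.
- by move=> P Q s t est; apply/val_inj/linking_delta_inj.
- move=> P Q f.
  have [g eg] := @Xtheta_lift _ _ _ _ _ theta (inT P) (inT Q) _ (valP f).
  by exists (quot_class (EK' P) g); apply: val_inj; rewrite linking_piE eg.
- move=> P Q; elim/linking_ind=> g z zZ; rewrite linking_deltaE linking_cmpE.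
  move/esym/quot_classP=> [a aEK' ea]; have [b bEK eb] := ZX_EcapK zZ.
  apply: (EK'_hat1 aEK'); rewrite -eb; congr val.
  apply: (cmp_Eker_inj (EcapK_Eker bEK) _ (_ : g \co val b = g \co val a)).
    by case/EK'P: aEK' => /EcapK_Eker.
  by rewrite eb.
- move=> P Q; elim/linking_ind=> g; elim/linking_ind=> g'; split.
    move/(congr1 val); rewrite !linking_piE => -[ec es].
    have [z zZ ez] := linking_orbit ec es; exists z => //.
    by rewrite linking_deltaE linking_cmpE.
  case=> z zZ; rewrite linking_deltaE linking_cmpE => ->; apply: val_inj.
  rewrite !linking_piE conjmM srepM; have [b /EcapKP[cb sb] <-] := ZX_EcapK zZ.
  by rewrite cb sb mul1g (fcompf1 (conjm_injs g)).
- by move=> P x Px; rewrite linking_deltaE linking_piE conjm_hatm srep_hatm.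
- move=> P Q; elim/linking_ind=> g x y Px ey.
  rewrite !linking_deltaE !linking_cmpE; congr (quot_class _ _).
  by apply: hatm_equiv => //; rewrite ey linking_piE.
Qed.

End LinkingActionSystem.

Theorem proposition3p4p14 (p : nat) (p_pr : prime p)
    (S : finGroupType) (pS : p.-group [set: S])
    (F : fusion_system S) (satF : saturated F p)
    (T : transporter_system p F)
    (X : finType) (theta : sym_rep T X)
    (cX_ob : Xcentric (Xtheta theta) \subset tr_ob T) :
  let XX := Xtheta theta in
  let cX := Xcentric XX in
  let inT : sgr cX -> sgr (tr_ob T) := sgr_sub cX_ob in
  exists EK : forall P : sgr cX, {group catAut T (inT P)},
    (forall P : sgr cX,
       unique (fun A : {group catAut T (inT P)} =>
                 p^'.-group A /\
                 hat (tr_delta T) (inT P) (ZX (theta_action theta) P) \x A =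
                   Eker (inT P) :&: Kker theta (inT P))
              (EK P)) /\
    (forall P : sgr cX,
       EK P = [set g in Eker (inT P) :&: Kker theta (inT P) | p^'.-elt g]
         :> {set catAut T (inT P)}) /\
    exists Lclass : cat_class (fun P Q : sgr cX => quot_hom (inT Q) (EK P)),
    let L : category (sgr cX) := Cat Lclass in
    exists (q : functor (full_sub inT T) L id)
           (delta : functor (trcat cX) L id)
           (pi : functor L (full_sub (@sgr_val S cX) (xcat XX)) id),
      [/\ forall (P Q : sgr cX) (g : T (inT P) (inT Q)),
            fmap q (P := P) (Q := Q) g = quot_class (EK P) g,
          forall (P Q : sgr cX) (s : trcat cX P Q),
            fmap delta s =
            quot_class (EK P)
              (fmap (tr_delta T) (s : trcat (tr_ob T) (inT P) (inT Q))),
          forall (P Q : sgr cX) (g : T (inT P) (inT Q)),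
            val (fmap pi (P := P) (Q := Q) (quot_class (EK P) g)) =
            (val (fmap (tr_pi T) g), srep theta g)
        & linking_action_system delta pi].
Proof.
move=> XX cX inT; exists (EK' (theta := theta) cX_ob); split=> [P|].
  split=> [|A [p'A defA]].
    by split; [apply: pcore_pgroup | apply: (EcapK_dprod pS)].
  apply: group_inj; rewrite (EK'E pS).
  by rewrite (EcapK_dprod_eq pS p'A defA).
split=> [P|]; first exact: (EK'E pS).
exists (hom_class (linking_cat pS cX_ob)) => L.
exists (quot_functor (EK'_push pS (cX_ob := cX_ob))).
exists (linking_delta pS cX_ob), (linking_pi pS cX_ob); split=> //.
- by move=> P Q g; apply: linking_piE.
- exact: linking_systemP.
Qed.
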